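(* Let $E: y^2=x^3+ax^2+bx+c$ ($a,b,c\in\mathbb{Z}$) be an elliptic curve and $P\in E(\mathbb{Q})$ a point of infinite order. Then \[\lim_{k\to\infty}\frac{\log F_k(E,P)}{4^k}=\frac{3}{8}\hat{h}(P).\]
   Context: An elliptic curve is a non-singular cubic $y^2=x^3+ax^2+bx+c$ with $a,b,c\in\mathbb{Z}$. For $k\ge0$ write $2^kP=\left(\frac{m_k}{e_k^2},\frac{n_k}{e_k^3}\right)$ with $m_k,n_k,e_k\in\mathbb{Z}$, $e_k\ge1$, $\gcd(m_k,e_k)=\gcd(n_k,e_k)=1$. Define $F_0(E,P)=e_0$ and $F_k(E,P)=e_k/e_{k-1}$ for $k\ge1$. The height of a point $Q=\left(\frac{m}{e^2},\frac{n}{e^3}\right)$ (in lowest terms) is $h(Q)=\log\max(|m|,e^2)$, and the canonical height is $\hat{h}(P)=\lim_{k\to\infty}h(2^kP)/4^k$. *)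

(* Defs.v *)
From HB Require Import structures.
From mathcomp Require Import all_boot all_order all_algebra all_field.
From mathcomp Require Import all_classical all_reals all_analysis.
From mathcomp Require Import ring.

Set Implicit Arguments.
Unset Strict Implicit.
Unset Printing Implicit Defensive.

Import Order.TTheory GRing.Theory Num.Theory.
Import numFieldNormedType.Exports.

Local Open Scope classical_set_scope.
Local Open Scope ring_scope.

(* [Cubic a b c] stands for the curve y^2 = x^3 + a x^2 + b x + c. *)
Record cubic := Cubic { coef_a : int; coef_b : int; coef_c : int }.

Definition cubic_poly (K : comNzRingType) (E : cubic) : {poly K} :=
  'X^3 + (coef_a E)%:~R *: 'X^2 + (coef_b E)%:~R *: 'X + (coef_c E)%:~R%:P.

(* The partial derivatives of y^2 - f(x) are 2 y and - f'(x).  Singular points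
   are sought over the algebraic closure of the rationals; the point at
   infinity [0 : 1 : 0] of such a cubic is always smooth.  The usual notation
   for [deriv] is taken over by [derive1] of analysis. *)
Definition singular_point (E : cubic) (x y : algC) : Prop :=
  let f := cubic_poly algC E in
  [/\ y ^+ 2 = f.[x], 2 * y = 0 & - (deriv f).[x] = 0].

Definition nonsingular (E : cubic) : Prop :=
  forall x y : algC, ~ singular_point E x y.

Inductive ec_point := Infinity | Affine of rat & rat.

Definition on_curve (E : cubic) (P : ec_point) : Prop :=
  match P with
  | Infinity => True
  | Affine x y => y ^+ 2 = (cubic_poly rat E).[x]
  end.

(* The slope of the chord through two affine points, or of the tangent when
   they coincide; only used when the two points are not opposite. *)
Definition slope (E : cubic) (x1 y1 x2 y2 : rat) : rat :=
  if x1 == x2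
  then (deriv (cubic_poly rat E)).[x1] / (2 * y1)
  else (y2 - y1) / (x2 - x1).

Definition add_point (E : cubic) (P Q : ec_point) : ec_point :=
  match P, Q with
  | Infinity, _ => Q
  | _, Infinity => P
  | Affine x1 y1, Affine x2 y2 =>
      if (x1 == x2) && (y1 == - y2) then Infinity
      else
        let s := slope E x1 y1 x2 y2 in
        let x3 := s ^+ 2 - (coef_a E)%:~R - x1 - x2 in
        Affine x3 (s * (x1 - x3) - y1)
  end.

Definition mul_point (E : cubic) (n : nat) (P : ec_point) : ec_point :=
  iter n (add_point E P) Infinity.

Definition infinite_order (E : cubic) (P : ec_point) : Prop :=
  forall n : nat, (0 < n)%N -> mul_point E n P <> Infinity.

Lemma horner_cubic (K : comNzRingType) (E : cubic) (x : K) :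
  (cubic_poly K E).[x] =
  x ^+ 3 + (coef_a E)%:~R * x ^+ 2 + (coef_b E)%:~R * x + (coef_c E)%:~R.
Proof. by rewrite /cubic_poly !hornerE. Qed.

Lemma horner_deriv_cubic (K : comNzRingType) (E : cubic) (x : K) :
  (deriv (cubic_poly K E)).[x] =
  3 * x ^+ 2 + 2 * (coef_a E)%:~R * x + (coef_b E)%:~R.
Proof. rewrite /cubic_poly !poly.derivE !hornerE /=; ring. Qed.

Lemma tangent_identity (K : fieldType) (a b c x y : K) : 2 * y != 0 ->
  y ^+ 2 = x ^+ 3 + a * x ^+ 2 + b * x + c ->
  let s := (3 * x ^+ 2 + 2 * a * x + b) / (2 * y) in
  let x3 := s ^+ 2 - a - x - x in
  (s * (x - x3) - y) ^+ 2 = x3 ^+ 3 + a * x3 ^+ 2 + b * x3 + c.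
Proof.
move=> y0 h s x3.
have hs : s * (2 * y) = 3 * x ^+ 2 + 2 * a * x + b by rewrite divfK.
have -> : b = s * (2 * y) - 3 * x ^+ 2 - 2 * a * x by rewrite hs; ring.
have -> : c = y ^+ 2 - x ^+ 3 - a * x ^+ 2 - b * x by rewrite h; ring.
have -> : b = s * (2 * y) - 3 * x ^+ 2 - 2 * a * x by rewrite hs; ring.
rewrite /x3; move: s {hs x3} => s; ring.
Qed.

Lemma chord_identity (K : fieldType) (a b c x1 y1 x2 y2 : K) : x2 - x1 != 0 ->
  y1 ^+ 2 = x1 ^+ 3 + a * x1 ^+ 2 + b * x1 + c ->
  y2 ^+ 2 = x2 ^+ 3 + a * x2 ^+ 2 + b * x2 + c ->
  let s := (y2 - y1) / (x2 - x1) in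
  let x3 := s ^+ 2 - a - x1 - x2 in
  (s * (x1 - x3) - y1) ^+ 2 = x3 ^+ 3 + a * x3 ^+ 2 + b * x3 + c.
Proof.
move=> dx h1 h2 s x3.
have hy : y2 = y1 + s * (x2 - x1) by rewrite divfK //; ring.
have hb : b = s * (y1 + y2) - (x2 ^+ 2 + x1 * x2 + x1 ^+ 2) - a * (x2 + x1).
  apply: (mulIf dx).
  have -> : b * (x2 - x1) = y2 ^+ 2 - y1 ^+ 2 - (x2 ^+ 3 - x1 ^+ 3)
     - a * (x2 ^+ 2 - x1 ^+ 2) by rewrite h1 h2; ring.
  rewrite hy; ring.
have -> : c = y1 ^+ 2 - x1 ^+ 3 - a * x1 ^+ 2 - b * x1 by rewrite h1; ring.
rewrite hb hy /x3; move: s {hy hb x3} => s; ring.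
Qed.

Lemma on_curve_add (E : cubic) (P Q : ec_point) :
  on_curve E P -> on_curve E Q -> on_curve E (add_point E P Q).
Proof.
case: P => [|x1 y1] //; case: Q => [|x2 y2] //=.
rewrite !horner_cubic => h1 h2; case: ifP => //= hopp.
rewrite horner_cubic /slope; case: eqP hopp => [ex|/eqP nx] /= ny.
  subst x2; have {}ny := negbT ny.
  have /eqP : (y1 - y2) * (y1 + y2) = 0 by rewrite -subr_sqr h1 h2 subrr.
  rewrite mulf_eq0 subr_eq0 addr_eq0 (negPf ny) orbF => /eqP ey.
  rewrite horner_deriv_cubic; apply: tangent_identity => //.
  by move: ny; rewrite -ey -addr_eq0 -mulr2n -(mulr_natl y1).
by apply: chord_identity => //; rewrite subr_eq0 eq_sym.
Qed.

Lemma on_curve_mul (E : cubic) (n : nat) (P : ec_point) :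
  on_curve E P -> on_curve E (mul_point E n P).
Proof. by move=> hP; elim: n => //= n IHn; exact: on_curve_add. Qed.

(* [Q = (m / e ^ 2, n / e ^ 3)] in lowest terms, for [t = (m, n, e)]. *)
Definition lowest_terms (Q : ec_point) (t : int * int * int) : Prop :=
  let: (m, n, e) := t in
  [/\ Q = Affine (m%:Q / e%:Q ^+ 2) (n%:Q / e%:Q ^+ 3), 1 <= e,
      coprimez m e & coprimez n e].

Lemma lowest_terms_exists (E : cubic) (x y : rat) :
  on_curve E (Affine x y) -> exists t, lowest_terms (Affine x y) t.
Proof.
rewrite /= horner_cubic; set a := coef_a E; set b := coef_b E; set c := coef_c E.
set p := numq x; set q := denq x; set r := numq y; set s := denq y => h.
have q0 : q%:Q != 0 by rewrite intr_eq0 denq_neq0.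
have s0 : s%:Q != 0 by rewrite intr_eq0 denq_neq0.
have ex : x = p%:Q / q%:Q by rewrite divq_num_den.
have ey : y = r%:Q / s%:Q by rewrite divq_num_den.
have cpq : coprimez p q by exact: coprime_num_den.
have crs : coprimez r s by exact: coprime_num_den.
set N := p ^+ 3 + q * (a * p ^+ 2 + b * p * q + c * q ^+ 2).
have hN : r ^+ 2 * q ^+ 3 = s ^+ 2 * N.
  apply: (@intr_inj rat); rewrite /N.
  have : (r%:Q / s%:Q) ^+ 2 * (s%:Q ^+ 2 * q%:Q ^+ 3) =
    ((p%:Q / q%:Q) ^+ 3 + a%:Q * (p%:Q / q%:Q) ^+ 2 + b%:Q * (p%:Q / q%:Q) + c%:Q)
     * (s%:Q ^+ 2 * q%:Q ^+ 3) by rewrite -ex -ey h.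
  have -> : (r%:Q / s%:Q) ^+ 2 * (s%:Q ^+ 2 * q%:Q ^+ 3) = r%:Q ^+ 2 * q%:Q ^+ 3
    by field.
  rewrite !(intrD, intrM, rmorphXn) /= => ->; by field; rewrite ?q0.
have cqN : coprimez (q ^+ 3) N.
  apply: coprimezXl; rewrite /coprimez /N [q * _]mulrC [p ^+ 3 + _]addrC gcdzMDl.
  by rewrite -/(coprimez _ _) coprimezXr // coprimez_sym.
have d1 : (q ^+ 3 %| s ^+ 2)%Z.
  by rewrite -(Gauss_dvdzl _ cqN) -hN dvdz_mull.
have d2 : (s ^+ 2 %| q ^+ 3)%Z.
  have cc : coprimez (s ^+ 2) (r ^+ 2).
    by rewrite coprimezXl // coprimezXr // coprimez_sym.
  by rewrite -(Gauss_dvdzr _ cc) hN dvdz_mulr.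
have eqs : s ^+ 2 = q ^+ 3.
  have s2 : 0 <= s ^+ 2 by rewrite exprn_ge0 // ltW // denq_gt0.
  have q3 : 0 <= q ^+ 3 by rewrite exprn_ge0 // ltW // denq_gt0.
  rewrite -(gez0_abs s2) -(gez0_abs q3); congr Posz.
  by apply/eqP; rewrite eqn_dvd; apply/andP; split.
have /dvdzP [e se] : (q %| s)%Z.
  have : (q ^+ 2 %| s ^+ 2)%Z by rewrite eqs exprS dvdz_mull.
  by rewrite !dvdzE !abszX dvdn_pexp2r.
have qe : q = e ^+ 2.
  apply: (@mulIf _ (q ^+ 2)); first by rewrite expf_neq0 // denq_neq0.
  by rewrite -exprS -eqs se exprMn.
have se3 : s = e ^+ 3 by rewrite se qe -exprS.
have e0 : 1 <= e.
  have : 0 < s by exact: denq_gt0.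
  have : 0 < q by exact: denq_gt0.
  by rewrite se => q_gt0; rewrite pmulr_lgt0.
exists (p, r, e); split => //.
- by rewrite ex ey se3 qe !rmorphXn.
- by move: cpq; rewrite qe coprimez_pexpr.
- by move: crs; rewrite se3 coprimez_pexpr.
Qed.

Lemma lowest_terms_unique (Q : ec_point) (t u : int * int * int) :
  lowest_terms Q t -> lowest_terms Q u -> t = u.
Proof.
have red (m n e : int) : 1 <= e -> coprimez m e -> coprimez n e ->
    let x := m%:Q / e%:Q ^+ 2 in let y := n%:Q / e%:Q ^+ 3 in
    [/\ m = numq x, n = numq y, e ^+ 2 = denq x & 0 <= e].
  move=> e1 cm cn /=.
  have e0 : 0 < e by exact: lt_le_trans e1.
  rewrite -!rmorphXn /=.
  have c2 : coprime `|m| `|e ^+ 2| by move: (coprimezXr 2 cm).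
  have c3 : coprime `|n| `|e ^+ 3| by move: (coprimezXr 3 cn).
  rewrite !coprimeq_num // !coprimeq_den // !gtr0_sg ?exprn_gt0 // !mul1r.
  rewrite expf_eq0 (gt_eqF e0) /= gtr0_norm ?exprn_gt0 //; split=> //; exact: ltW.
case: t => [[m n] e]; case: u => [[m' n'] e'].
move=> [-> e1 c1 c2] [[ex ey] e1' c1' c2'].
have /= [em en he e0] := red _ _ _ e1 c1 c2.
have /= [em' en' he' e0'] := red _ _ _ e1' c1' c2'.
have /eqP : e ^+ 2 = e' ^+ 2 by rewrite he he' ex.
by rewrite eqrXn2 // => /eqP <-; rewrite em em' en en' ex ey.
Qed.

(* The default value is never taken at an affine point of a curve, see
   [coords_ofP]. *)
Definition coords_of (Q : ec_point) : int * int * int :=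
  xget (0, 0, 1) [set t | lowest_terms Q t].

Lemma coords_ofP (E : cubic) (x y : rat) :
  on_curve E (Affine x y) ->
  lowest_terms (Affine x y) (coords_of (Affine x y)).
Proof.
by move=> /lowest_terms_exists [t ht]; exact: (xgetPex _ (ex_intro _ t ht)).
Qed.

Definition num_x (Q : ec_point) : int := (coords_of Q).1.1.
Definition den (Q : ec_point) : int := (coords_of Q).2.

Definition F (E : cubic) (P : ec_point) (k : nat) : rat :=
  let e j := den (mul_point E (2 ^ j) P) in
  if k is k'.+1 then (e k)%:Q / (e k')%:Q else (e 0%N)%:Q.

Definition height (R : realType) (Q : ec_point) : R :=
  ln (Num.max `|num_x Q| (den Q ^+ 2))%:~R.

Definition canonical_height (R : realType) (E : cubic) (P : ec_point) : R :=
  limn (fun k : nat => height R (mul_point E (2 ^ k) P) / 4 ^+ k).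

(* Main.v *)
(* Write x_k for the abscissa of 2^k P and e_k^2 for its denominator.  The height
   satisfies h(2 Q) <= 4 h(Q) + O(1), so h(2^k P) / 4^k converges, and
   h(2^k P) = 2 log e_k + log max(1, |x_k|).  As log F_k = log e_k - log e_(k-1),
   everything reduces to log max(1, |x_k|) = o(4^k): the multiples 2^k P must not
   come too close to the origin in the real topology.

   If |x_k| >= theta^(4^k) for infinitely many k, pull back by 2^(i+2): the
   rational number xi = x_(k-i-2) is close to the abscissa of a point of exact
   order 2^(i+2), that is, to a root of a monic separable integral polynomial g of
   degree d = 6 * 4^i, and the exponent of approximation relative to the height
   of xi is of order 4^i.  Liouville's and Thue's exponents, linear in d, are not
   sufficient, but Siegel's exponent d / (s + 1) + s, of order sqrt d for the best s,
   contradicts the existence of two such approximations with very different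
   heights once i is large.  The auxiliary polynomial comes from Siegel's
   lemma, its partial derivatives P^[i](x, y) satisfying g(y) | P^[i](y, y) for
   i < r; its nonvanishing at the pair of approximations comes from a Wronskian. *)
Require Import Defs.
From HB Require Import structures.
From mathcomp Require Import all_boot all_order all_algebra all_field.
From mathcomp Require Import all_classical all_reals all_analysis.
From mathcomp Require Import ring lra zify.

Set Implicit Arguments.
Unset Strict Implicit.
Unset Printing Implicit Defensive.

Import Order.TTheory GRing.Theory Num.Theory.
Import numFieldNormedType.Exports.
Local Open Scope ring_scope.

(** * Wronskians and the zero estimate *)

(** No real algebraic number is named in the approximation argument: closeness to a root is measured
    by the rational number |g(x)|, and a pigeonhole selects approximations that lie close to each
    other, hence to the same root. Estimates are squared because iterated duplication expresses
    g(x)^2, not g(x), through the cubic at a later multiple.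

    Siegel's exponent suffices thanks to the order of the choices. Both d = 6 * 4^i and log tau, for
    tau = theta^(4 * 4^i), are proportional to 4^i. The condition on d / (s + 1) therefore does not
    involve i and fixes s; the condition on s then holds for i large.

    A separate obstacle is algebraic: [mul_point] adds P one copy at a time, so reading 2^k P as
    iterated duplication takes a form of associativity. Only the generic case Q + (P + Q) = P + 2 Q
    is computed, and infinite order excludes the degenerate positions. *)

Lemma size_lead_coef_deriv (F : numFieldType) (p : {poly F}) : (1 < size p)%N ->
  size (deriv p) = (size p).-1 /\
  lead_coef (deriv p) = lead_coef p *+ (size p).-1.
Proof.
move=> p1.
have e : (deriv p)`_(size p).-2 = lead_coef p *+ (size p).-1.
  by rewrite coef_deriv lead_coefE; case: (size p) p1 => [|[|n]].
have nz : (deriv p)`_(size p).-2 != 0.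
  rewrite e -mulr_natr mulf_neq0 //.
    by rewrite lead_coef_eq0 -size_poly_eq0; case: (size p) p1.
  by rewrite pnatr_eq0; case: (size p) p1 => [|[|n]].
have s : size (deriv p) = (size p).-1.
  apply/eqP; rewrite eqn_leq; apply/andP; split.
    have := @lt_size_deriv _ p; rewrite -size_poly_eq0.
    by case: (size p) p1 => [|n] //= _; apply.
  rewrite leqNgt; apply/negP => h; move: nz; rewrite nth_default ?eqxx //.
  by move: h p1; case: (size p) => [|[|n]].
by split=> //; rewrite lead_coefE s -e; case: (size p) p1 => [|[|n]].
Qed.

(** Comparing leading coefficients shows, in characteristic 0, that every nonzero solution has the
    degree of [v]. Subtracting the multiple of [v] that cancels the leading coefficient of [u]
    leaves a solution of smaller degree, which must be 0. *)
Lemma deriv_mul_eq_proportional (F : numFieldType) (u v : {poly F}) : v != 0 ->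
  deriv u * v = u * deriv v -> exists c, u = c *: v.
Proof.
move=> v0 huv.
have same_size (w : {poly F}) : w != 0 -> deriv w * v = w * deriv v ->
    size w = size v.
  have half (p q : {poly F}) : p != 0 -> q != 0 ->
      deriv p * q = p * deriv q -> (1 < size p)%N -> size p = size q.
    move=> p0 q0 e p1; have [sp lp] := size_lead_coef_deriv p1.
    have q1 : (1 < size q)%N.
      rewrite ltnNge; apply/negP => /size1_polyC qc.
      move: e; rewrite [in deriv q]qc derivC mulr0 => /eqP.
      rewrite mulf_eq0 (negPf q0) orbF -size_poly_eq0 sp.
      by case: (size p) p1 => [|[|n]].
    have [sq lq] := size_lead_coef_deriv q1.
    have /(congr1 lead_coef) := e; rewrite !lead_coefM lp lq mulrnAl mulrnAr.
    move/eqP; rewrite -!(mulr_natr (_ * _)) -subr_eq0 -mulrBr !mulf_eq0.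
    rewrite !lead_coef_eq0 (negPf p0) (negPf q0) /= subr_eq0 eqr_nat => /eqP.
    by case: (size p) p1 => [|n] //; case: (size q) q1 => [|m] //= _ _ ->.
  move=> w0 e; case: (ltnP 1 (size w)) => [w1|w1]; first exact: half.
  case: (ltnP 1 (size v)) => [v1|v1].
    by apply/esym/half => //; rewrite mulrC -e mulrC.
  apply/eqP; rewrite eqn_leq (leq_trans w1) ?(leq_trans v1) //;
    by rewrite lt0n size_poly_eq0.
exists (lead_coef u / lead_coef v); apply/eqP; rewrite -subr_eq0; apply/eqP.
set c := _ / _; set w := u - _.
have ew : deriv w * v = w * deriv v.
  rewrite /w derivB derivZ !mulrBl huv; congr (_ - _).
  by rewrite -!scalerAl mulrC.
apply/eqP; apply: contraT => w0.
have sw := same_size _ w0 ew.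
have u0 : u != 0.
  by apply: contra w0 => /eqP u0; rewrite /w /c u0 lead_coef0 mul0r scale0r subr0.
have su := same_size _ u0 huv.
suff : (size w < size v)%N by rewrite sw ltnn.
have hl : w`_(size v).-1 = 0.
  rewrite coefB coefZ -lead_coefE -{1}su -lead_coefE /c divfK ?subrr //.
  by rewrite lead_coef_eq0.
have := lead_coef_eq0 w; rewrite lead_coefE sw hl eqxx => /esym w00.
by rewrite w00 in w0.
Qed.

Definition wronskian (F : numFieldType) n (P : 'I_n -> {poly F}) : {poly F} :=
  \det (\matrix_(i, k) derivn i (P k)).

(** If the determinant vanished, the cofactors of its last row would give a relation with polynomial
    coefficients, the last of which is the nonzero Wronskian of the other polynomials.
    Differentiating it shows that the ratios of these coefficients are constant, which is a linear
    relation over [F]. *)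
Lemma wronskian_neq0 (F : numFieldType) n (P : 'I_n -> {poly F}) :
  (forall c : 'I_n -> F, \sum_k c k *: P k = 0 -> forall k, c k = 0) ->
  wronskian P != 0.
Proof.
elim: n P => [|n IHn] P indep; first by rewrite /wronskian det_mx00 oner_eq0.
pose P0 k := P (lift ord_max k).
have W0 : wronskian P0 != 0.
  apply: IHn => c hc k.
  pose c' (i : 'I_n.+1) := if unlift ord_max i is Some k then c k else 0.
  suff /indep/(_ (lift ord_max k)) : \sum_k c' k *: P k = 0 by rewrite /c' liftK.
  rewrite (bigD1 ord_max) //= /c' unlift_none scale0r add0r -[RHS]hc.
  rewrite (reindex_onto (lift ord_max) (fun i => odflt k (unlift ord_max i))) /=.
    apply: eq_big => [i|i _]; last by rewrite liftK.
    by rewrite liftK eq_sym neq_lift eqxx.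
  by move=> i; rewrite eq_sym; case/unlift_some => j -> ->.
apply/negP => /eqP W; pose M := \matrix_(i, k < n.+1) derivn i (P k).
pose v k := cofactor M ord_max k.
have v0 : v ord_max = wronskian P0.
  rewrite /v /cofactor /wronskian /= -signr_odd oddD addbb expr0 mul1r.
  by congr (\det _); apply/matrixP=> i k; rewrite !mxE; congr (derivn _ _); rewrite lift_max.
have Mv i : (i <= n)%N -> \sum_k v k * derivn i (P k) = 0.
  rewrite -ltnS => lti; have /matrixP/(_ (Ordinal lti) ord_max) := mul_mx_adj M.
  rewrite -/(wronskian P) W mxE [RHS]mxE mul0rn => {2}<-.
  by apply: eq_bigr => k _; rewrite !mxE mulrC.
(* This is the numerator of the derivative of [v k / v ord_max]. These numerators solve a
   homogeneous system whose determinant is [wronskian P0], so they vanish. *)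
pose u k := v ord_max * deriv (v k) - deriv (v ord_max) * v k.
have Mu i : (i < n)%N -> \sum_k u k * derivn i (P k) = 0.
  move=> lti; have /(congr1 (@deriv _)) := Mv i (ltnW lti).
  rewrite deriv0 raddf_sum /= => h.
  transitivity (v ord_max * (\sum_k deriv (v k * derivn i (P k)))
     - v ord_max * (\sum_k v k * derivn i.+1 (P k))
     - deriv (v ord_max) * (\sum_k v k * derivn i (P k))).
    rewrite !big_distrr /= -!sumrB; apply: eq_bigr => k _.
    by rewrite derivM -derivnS /u; ring.
  by rewrite h !Mv ?mulr0 ?subrr // ltnW.
have um : u ord_max = 0 by rewrite /u mulrC subrr.
have u0 k : u k = 0.
  case: (unliftP ord_max k) => [j ->|-> //].
  pose M0 := \matrix_(i, k < n) derivn i (P0 k).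
  pose uv := \col_k u (lift ord_max k).
  have : \adj M0 *m (M0 *m uv) = 0.
    suff -> : M0 *m uv = 0 by rewrite mulmx0.
    apply/colP=> i; rewrite !mxE -[RHS](Mu i) // [RHS](bigD1 ord_max) //= um mul0r add0r.
    rewrite (reindex_onto (lift ord_max) (fun i => odflt j (unlift ord_max i))) /=.
      apply: eq_big => [l|l _]; first by rewrite liftK eq_sym neq_lift eqxx.
      by rewrite !mxE mulrC.
    by move=> l; rewrite eq_sym; case/unlift_some => l' -> ->.
  rewrite mulmxA mul_adj_mx mul_scalar_mx => /colP/(_ j); rewrite !mxE => /eqP.
  by rewrite mulf_eq0 (negPf W0) /= => /eqP.
have vm : v ord_max != 0 by rewrite v0.
have /fin_all_exists [c hc] k : exists c, v k = c *: v ord_max.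
  apply: deriv_mul_eq_proportional => //; apply/eqP; rewrite -subr_eq0.
  by rewrite -[X in _ == X](u0 k) /u; apply/eqP; ring.
have : \sum_k c k *: P k = 0.
  have := Mv 0%N isT; under eq_bigr => k _ do
    rewrite hc derivn0 -scalerAl scalerAr.
  by rewrite -big_distrr /= => /eqP; rewrite mulf_eq0 (negPf vm) => /eqP.
move/indep/(_ ord_max) => c0.
by move: vm; rewrite hc c0 scale0r eqxx.
Qed.

Lemma size_wronskian (F : numFieldType) n D (P : 'I_n -> {poly F}) :
  (forall k, (size (P k) <= D.+1)%N) -> (size (wronskian P) <= (n * D).+1)%N.
Proof.
move=> hP; rewrite /wronskian /determinant.
apply: (big_ind (fun q : {poly F} => size q <= (n * D).+1)%N) => [|p q hp hq|s _].
- by rewrite size_poly0.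
- by rewrite (leq_trans (size_polyD _ _)) // geq_max hp hq.
rewrite mulr_sign (fun_if (fun q : {poly F} => size q)) size_polyN if_same.
rewrite (leq_trans (size_poly_prod_leq _ _)) // cardT size_enum_ord.
rewrite leq_subLR addnS ltnS.
have -> : (n + n * D = \sum_(i < n) D.+1)%N.
  by rewrite sum_nat_const card_ord mulnS.
apply: leq_sum => i _; rewrite mxE; move: (P _) (hP (perm.fun_of_perm.body s i)) => q hq.
apply: leq_trans hq; elim: (i : nat) => [|j IH]; rewrite ?derivn0 // derivnS.
apply: leq_trans IH; have [->|/lt_size_deriv/ltnW //] := eqVneq (derivn j q) 0.
by rewrite deriv0.
Qed.

Lemma dvdp_XsubC_deriv (F : fieldType) (a : F) n (S : {poly F}) :
  ('X - a%:P) ^+ n %| S -> ('X - a%:P) ^+ n.-1 %| deriv S.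
Proof.
case: n => [|n]; first by rewrite /= expr0 !dvd1p.
move=> /dvdpP [q ->] /=; rewrite derivM deriv_exp /= dvdp_addl.
  by apply: dvdp_mull; rewrite exprS; apply: dvdp_mull.
by apply: dvdp_mull; rewrite -mulr_natl mulrA; apply: dvdp_mull.
Qed.

Lemma dvdp_XsubC_derivn (F : fieldType) (a : F) n i (S : {poly F}) :
  ('X - a%:P) ^+ n %| S -> ('X - a%:P) ^+ (n - i) %| derivn i S.
Proof.
elim: i => [|i IH] h; first by rewrite subn0 derivn0.
by rewrite subnS derivnS dvdp_XsubC_deriv // IH.
Qed.

(** By Cramer's rule [c k] times the Wronskian is a combination of the derivatives of the sum of
    order at most [n], and each derivation loses at most one factor. *)
Lemma dvdp_wronskian (F : numFieldType) n (P : 'I_n.+1 -> {poly F})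
    (c : 'I_n.+1 -> F) a r k :
  c k != 0 -> ('X - a%:P) ^+ r %| \sum_k c k *: P k ->
  ('X - a%:P) ^+ (r - n) %| wronskian P.
Proof.
move=> ck hr; pose M := \matrix_(i, k < n.+1) derivn i (P k).
have : \adj M *m (M *m \col_k (c k)%:P) = (wronskian P)%:M *m \col_k (c k)%:P.
  by rewrite mulmxA mul_adj_mx.
rewrite mul_scalar_mx => /colP/(_ k); rewrite !mxE => h.
rewrite -(dvdpZr _ _ ck) -mul_polyC mulrC -h.
apply: (big_ind (fun q => _ %| q)) => [|x y hx hy|i _]; rewrite ?dvdp0 ?dvdp_add //.
rewrite dvdp_mull // mxE.
have -> : \sum_j M i j * (\col_k0 (c k0)%:P) j 0 = derivn i (\sum_k c k *: P k).
  rewrite linear_sum /=; apply: eq_bigr => j _.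
  by rewrite !mxE derivnZ mulrC mul_polyC.
apply: dvdp_trans (dvdp_XsubC_derivn i hr).
by rewrite dvdp_exp2l // leq_sub2l // -ltnS.
Qed.

Lemma dvdp_prod_coprime (F : fieldType) (I : eqType) (s : seq I)
    (q : I -> {poly F}) W : uniq s ->
  {in s &, forall i j, i != j -> coprimep (q i) (q j)} ->
  {in s, forall i, q i %| W} -> \prod_(i <- s) q i %| W.
Proof.
elim: s => [|i s IH] /=; first by rewrite big_nil dvd1p.
move=> /andP[nis us] cop dv; rewrite big_cons Gauss_dvdp.
  rewrite dv ?mem_head // IH // => [j k js ks|j js]; last by rewrite dv ?inE ?js ?orbT.
  by apply: cop; rewrite inE ?js ?ks orbT.
rewrite big_seq; apply: (big_ind (fun p => coprimep (q i) p)) => [|a b ha hb|j js].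
- exact: coprimep1.
- by rewrite coprimepMr ha hb.
by apply: cop; rewrite ?mem_head ?inE ?js ?orbT //; apply: contra nis => /eqP ->.
Qed.

(** The coefficients of the Lagrange interpolation polynomials form a right inverse of this
    Vandermonde matrix. *)
Lemma row_free_powers (F : fieldType) (t s : nat) (b : 'I_t -> F) : injective b ->
  (t <= s)%N -> \rank (\matrix_(i < t, l < s) b i ^+ l) = t.
Proof.
move=> bi ts; apply/eqP; rewrite -/(row_free _).
apply/row_freeP; pose w (i : 'I_t) : {poly F} := \prod_(j | j != i) ('X - (b j)%:P).
have wE i j : (w i).[b j] = if i == j then (w i).[b i] else 0.
  case: eqP => [->|/eqP ij] //; rewrite /w horner_prod (bigD1 j) 1?eq_sym //=.
  by rewrite !hornerE subrr mul0r.
have w0 i : (w i).[b i] != 0.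
  rewrite horner_prod; apply/prodf_neq0 => j ji.
  by rewrite !hornerE subr_eq0; apply: contra ji => /eqP/bi ->.
have sw i : (size (w i) <= s)%N.
  apply: leq_trans ts; rewrite /w -big_filter size_prod_XsubC.
  have -> : size [seq j <- index_enum 'I_t | j != i] = #|predC1 i|.
    rewrite cardE /enum_mem -enumT; congr size; rewrite enumT.
    by apply: eq_filter => j; rewrite inE.
  by rewrite cardC1 card_ord prednK // (leq_ltn_trans _ (ltn_ord i)).
exists (\matrix_(l, i) ((w i)`_l / (w i).[b i])).
apply/matrixP => i j; rewrite !mxE.
transitivity ((w j).[b i] / (w j).[b j]).
  rewrite (horner_coef_wide _ (sw j)) big_distrl /=.
  by apply: eq_bigr => l _; rewrite !mxE mulrCA mulrA.
by rewrite wE; case: (eqVneq j i) => [->|ji]; rewrite ?divff ?mul0r.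
Qed.

(** Let S(x, y) be the sum of the p_l(x) y^l. A rank factorization of its coefficient matrix writes
    S through m + 1 independent polynomials, whose Wronskian has degree at most (m + 1) D. It is
    divisible by (X - a_i)^(r_i - m) unless S(x, b_i) is identically 0; there are at most s - m such
    exceptional i, each contributing at most D. *)
Lemma zero_estimate (F : numFieldType) (s D N : nat) (p : 'I_s.+1 -> {poly F})
    (a b : 'I_N -> F) (r : 'I_N -> nat) :
  (forall l, (size (p l) <= D.+1)%N) -> (exists l, p l != 0) ->
  injective a -> injective b -> (forall i, (r i <= D)%N) ->
  (forall i, ('X - (a i)%:P) ^+ r i %| \sum_(l < s.+1) b i ^+ l *: p l) ->
  (\sum_i r i <= s.+1 * D + N * s)%N.
Proof.
move=> sp [l0 pl0] ai bi rD hdv.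
pose C : 'M[F]_(s.+1, D.+1) := \matrix_(l, j) (p l)`_j.
have C0 : C != 0.
  apply: contra pl0 => /eqP/matrixP h; apply/eqP/polyP => j; rewrite coef0.
  case: (ltnP j D.+1) => [jD|jD]; first by have := h l0 (Ordinal jD); rewrite !mxE.
  by rewrite nth_default // (leq_trans (sp _)).
have [m rkC] : exists m, \rank C = m.+1.
  by exists (\rank C).-1; rewrite prednK // lt0n mxrank_eq0.
have [Bc [Pr [CE fB fP]]] : exists (Bc : 'M[F]_(s.+1, m.+1)) (Pr : 'M[F]_(m.+1, D.+1)),
    [/\ C = Bc *m Pr, \rank Bc = m.+1 & row_free Pr].
  rewrite -rkC; exists (col_base C), (row_base C).
  by rewrite mulmx_base row_base_free; have := col_base_full C; rewrite /row_full => /eqP ->.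
pose P k : {poly F} := rVpoly (row k Pr).
have sP k : (size (P k) <= D.+1)%N by exact: size_poly.
have PE (c : 'I_m.+1 -> F) : \sum_k c k *: P k = rVpoly ((\row_k c k) *m Pr).
  rewrite mulmx_sum_row linear_sum; apply: eq_bigr => k _.
  by rewrite linearZ /= mxE.
have pE l : p l = \sum_k Bc l k *: P k.
  rewrite PE; have -> : (\row_k Bc l k) = row l Bc by apply/rowP=> k; rewrite !mxE.
  rewrite -row_mul -CE; apply/polyP => j; rewrite coef_rVpoly.
  case: insubP => [u _ /= <-|]; first by rewrite !mxE.
  by rewrite -leqNgt => jD; rewrite nth_default // (leq_trans (sp _)).
have W0 : wronskian P != 0.
  apply: wronskian_neq0 => c; rewrite PE => /(congr1 (@poly_rV _ D.+1)).
  rewrite rVpolyK linear0 => h k.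
  have : (\row_k c k) *m Pr *m pinvmx Pr = 0 by rewrite h mul0mx.
  by rewrite mulmxKp // => /rowP/(_ k); rewrite !mxE.
pose B i (k : 'I_m.+1) := \sum_(l < s.+1) b i ^+ l * Bc l k.
have SE i : \sum_(l < s.+1) b i ^+ l *: p l = \sum_k B i k *: P k.
  under eq_bigr => l _ do rewrite pE scaler_sumr.
  rewrite exchange_big /=; apply: eq_bigr => k _.
  by rewrite scaler_suml; apply: eq_bigr => l _; rewrite scalerA.
pose T := [set i | [forall k, B i k == 0]].
(* The rows of powers of the distinct [b i], for [i] in [T], are independent and annihilate [Bc],
   which has rank [m.+1]. *)
have cT : (#|T| + m.+1 <= s.+1)%N.
  have key t (f : 'I_t -> 'I_N) : injective f -> (forall i, f i \in T) ->
      (t <= s.+1)%N -> (t + m.+1 <= s.+1)%N.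
    move=> fi fT ts.
    have := mulmx0_rank_max (A := \matrix_(i < t, l < s.+1) (b (f i)) ^+ l) (B := Bc).
    rewrite row_free_powers ?fB //; last by apply: inj_comp.
    apply; apply/matrixP => i k; rewrite !mxE.
    have := fT i; rewrite inE => /forallP/(_ k)/eqP; rewrite /B => h; rewrite -[RHS]h.
    by apply: eq_bigr => l _; rewrite mxE.
  case: (leqP #|T| s.+1) => hT.
    by apply: key (@enum_val _ _) (@enum_val_inj _ _) _ hT => i; exact: enum_valP.
  have := key s.+1 (fun i => @enum_val _ (mem T) (widen_ord (ltnW hT) i)) _ _ (leqnn _).
  rewrite addnS -ltn_subRL subnn ltn0 => h; exfalso.
  suff : false by []. apply: h => [i j /enum_val_inj/(congr1 val) /= e|i]; last exact: enum_valP.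
  exact: val_inj.
have dvW i : i \notin T -> ('X - (a i)%:P) ^+ (r i - m) %| wronskian P.
  rewrite inE negb_forall => /existsP [k Bk].
  by apply: (@dvdp_wronskian _ _ _ (B i) _ _ k) => //; rewrite -SE.
have dvp : \prod_(i <- enum (~: T)) ('X - (a i)%:P) ^+ (r i - m) %| wronskian P.
  apply: dvdp_prod_coprime; first exact: enum_uniq.
    move=> i j _ _ ij; apply: coprimep_expl; apply: coprimep_expr.
    by apply: coprimep_XsubC2; rewrite subr_eq0; apply: contra ij => /eqP/ai ->.
  by move=> i; rewrite mem_enum inE => /dvW.
have := dvdp_leq W0 dvp; rewrite big_enum /= size_prod; last first.
  by move=> i _; rewrite expf_neq0 // polyXsubC_eq0.
move=> /leq_trans/(_ (size_wronskian sP)).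
have -> : (\sum_(i in ~: T) size (('X - (a i)%:P) ^+ (r i - m)) =
          \sum_(i in ~: T) (r i - m) + #|~: T|)%N.
  rewrite -sum1_card -big_split; apply: eq_bigr => i _ /=.
  by rewrite size_exp_XsubC addn1.
rewrite -addSn addnK ltnS => hsum.
have h1 : (\sum_(i in T) r i <= #|T| * D)%N.
  by rewrite -sum_nat_const; apply: leq_sum.
have h2 : (\sum_(i in ~: T) r i <= \sum_(i in ~: T) (r i - m) + #|~: T| * m)%N.
  rewrite -sum_nat_const -big_split; apply: leq_sum => i _ /=.
  by rewrite addnC -leq_subLR.
rewrite (bigID (mem T)) /=.
have -> : (\sum_(i | i \notin T) r i = \sum_(i in ~: T) r i)%N.
  by apply: eq_bigl => i; rewrite finset.in_setC.
have h3 : (#|~: T| <= N)%N by rewrite -[leqRHS](card_ord N) max_card.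
have h4 : (#|T| * D + m.+1 * D <= s.+1 * D)%N by rewrite -mulnDl leq_mul2r cT orbT.
have h5 : (#|~: T| * m <= N * s)%N by apply: leq_mul => //; lia.
apply: leq_trans (leq_add h1 h2) _; rewrite addnA leq_add //.
by rewrite (leq_trans _ h4) // leq_add2l.
Qed.

(** * The auxiliary polynomial *)

Lemma absz_sum (I : finType) (P : pred I) (f : I -> int) (Y : I -> nat) :
  (forall i, P i -> (`|f i| <= Y i)%N) ->
  (`|(\sum_(i | P i) f i)%R| <= \sum_(i | P i) Y i)%N.
Proof.
move=> h; rewrite -lez_nat abszE (le_trans (ler_norm_sum _ _ _)) //.
rewrite (big_morph Posz PoszD (erefl _)); apply: ler_sum => i Pi; rewrite -abszE lez_nat; exact: h.
Qed.

(** Pigeonhole: the vectors with entries in [0, X] outnumber the possible values of the linear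
    forms, so two of them have the same values and their difference is a solution. The values are
    shifted by [Y] to become natural numbers. *)
Lemma siegel (I J : finType) (A : J -> I -> int) (a X : nat) :
  (forall j i, `|A j i| <= a)%N ->
  ((2 * (#|I| * (a * X))).+1 ^ #|J| < X.+1 ^ #|I|)%N ->
  exists v : I -> int, [/\ exists i, v i != 0, forall i, (`|v i| <= X)%N &
    forall j, \sum_i A j i * v i = 0].
Proof.
move=> Aa hc; set Y := (#|I| * (a * X))%N in hc.
have bnd (v : I -> int) j : (forall i, `|v i| <= X)%N ->
    (`|(\sum_i A j i * v i)%R| <= Y)%N.
  move=> hv; rewrite /Y -sum_nat_const.
  apply: absz_sum => i _; rewrite abszM; exact: leq_mul.
pose L (u : {ffun I -> 'I_X.+1}) j := \sum_i A j i * (u i : nat)%:Z.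
have Lb u j : (`|L u j| <= Y)%N by apply: bnd => i; rewrite absz_nat -ltnS.
pose f (u : {ffun I -> 'I_X.+1}) : {ffun J -> 'I_(2 * Y).+1} :=
  [ffun j => inord `|L u j + Y%:Z|].
have : ~~ injectiveb f.
  apply/negP => /injectiveP /leq_card; rewrite !card_ffun !card_ord leqNgt.
  by rewrite hc.
move=> /injectivePn [u [w uw fuw]].
exists (fun i => (u i : nat)%:Z - (w i : nat)%:Z); split.
- have /existsP [i hi] : [exists i, u i != w i].
    rewrite -negb_forall; apply: contra uw => /forallP h.
    by apply/eqP/ffunP => i; apply/eqP.
  by exists i; rewrite subr_eq0 eqz_nat.
- by move=> i; have := ltn_ord (u i); have := ltn_ord (w i); lia.
move=> j; have : val (f u j) = val (f w j) by rewrite fuw.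
rewrite /= !ffunE !inordK; last first.
- by have := Lb u j; lia.
- by have := Lb w j; lia.
move=> e; have : L u j = L w j by have := Lb u j; have := Lb w j; lia.
move=> {}e; under eq_bigr => i _ do rewrite mulrBr.
by rewrite sumrB -/(L u j) -/(L w j) e subrr.
Qed.

(** Division of X^n by a monic [g], one factor X at a time. This form makes the growth of the
    coefficients visibly exponential in [n], with a base depending only on [g]. *)
Fixpoint rem_exp (g : {poly int}) n : {poly int} :=
  if n is n'.+1 then
    'X * rem_exp g n' - (rem_exp g n')`_(size g).-2 *: g
  else 1.

Fixpoint quo_exp (g : {poly int}) n : {poly int} :=
  if n is n'.+1 then 'X * quo_exp g n' + ((rem_exp g n')`_(size g).-2)%:P
  else 0.

Lemma exp_quo_rem g n : 'X^n = quo_exp g n * g + rem_exp g n.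
Proof.
elim: n => [|n IH] /=; first by rewrite expr0 mul0r add0r.
by rewrite exprS IH -mul_polyC; ring.
Qed.

Lemma size_rem_exp g n : g \is monic -> (1 < size g)%N ->
  (size (rem_exp g n) < size g)%N.
Proof.
move=> gm g1; elim: n => [|n IH] /=; first by rewrite size_poly1.
have [m gE] : exists m, size g = m.+2.
  by exists (size g).-2; move: g1; case: (size g) => [|[|]].
have := monicP gm; rewrite lead_coefE gE /= => gm1; rewrite gE /= in IH *.
rewrite ltnS; apply/leq_sizeP => j hj; rewrite coefB coefXM coefZ.
case: j hj => // j hj /=; rewrite ltnS in hj.
case: (ltngtP m j) hj => // [hj|<-] _; last by rewrite gm1 mulr1 subrr.
have -> : g`_j.+1 = 0 by rewrite nth_default // gE.
have -> : (rem_exp g n)`_j = 0 by rewrite nth_default // (leq_trans _ hj).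
by rewrite mulr0 subrr.
Qed.

(** The successor makes one step of [rem_exp] cost exactly one factor b: b^n + b^n (b - 1) =
    b^(n+1). *)
Definition coef_bound (g : {poly int}) : nat := (\sum_(i < size g) `|(g`_i)%R|).+1.

Lemma coef_boundP (g : {poly int}) i : (`|(g`_i)%R| < coef_bound g)%N.
Proof.
rewrite /coef_bound ltnS; case: (ltnP i (size g)) => hi; last by rewrite nth_default.
by rewrite (bigD1 (Ordinal hi)) //= leq_addr.
Qed.

Lemma coef_rem_exp g n i : (`|((rem_exp g n)`_i)%R| <= coef_bound g ^ n)%N.
Proof.
elim: n i => [|n IH] i /=; first by rewrite coef1; case: (i == 0%N).
rewrite coefB coefXM coefZ.
have := coef_boundP g i; set b := coef_bound g; set c := (rem_exp g n)`_(size g).-2 => hg.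
have hc : (`|c| <= b ^ n)%N by exact: IH.
have h1 : (`|(if i == 0%N then 0 else (rem_exp g n)`_i.-1)%R| <= b ^ n)%N.
  by case: (i == 0%N).
have h2 : (`|(c * g`_i)%R| <= b ^ n * b.-1)%N by rewrite abszM leq_mul //; lia.
have b0 : (0 < b)%N by [].
rewrite expnSr -[X in (_ <= _ * X)%N](prednK b0) mulnS.
apply: leq_trans (leq_add h1 h2).
by move: (if _ then _ else _) (c * _) => u v; lia.
Qed.

Lemma normr_intr (z : int) : `|z%:~R : rat| = `|z|%N%:R.
Proof. by rewrite -[RHS]/((Posz _)%:~R) abszE -intr_norm. Qed.

Lemma quo_exp_bound g n M (x : rat) : `|x| <= M%:R ->
  `|(map_poly intr (quo_exp g n)).[x]| <= ((M + coef_bound g) ^ n)%:R.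
Proof.
move=> xM; elim: n => [|n IH] /=; first by rewrite map_poly0 horner0 normr0.
rewrite rmorphD rmorphM /= map_polyX map_polyC /= hornerD hornerM hornerX hornerC.
rewrite (le_trans (ler_normD _ _)) // normrM expnS natrM natrD mulrDl lerD //.
  by apply: ler_pM.
rewrite normr_intr -natrM ler_nat.
apply: leq_trans (coef_rem_exp _ _ _) _; rewrite -[leqLHS]mul1n leq_mul //.
by case: n {IH} => // n; rewrite leq_exp2r // leq_addl.
Qed.

Lemma bin_leq_exp2 n i : ('C(n, i) <= 2 ^ n)%N.
Proof.
elim: n i => [|n IH] [|i]; rewrite ?bin0 ?expn_gt0 //.
by rewrite binS expnS mul2n -addnn leq_add.
Qed.

(** The unknowns are the coefficients of P(x, y), the sum of the p_l(x) y^l; the equations say that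
    the remainders of P^[i](y, y) modulo [g] vanish. The ratio (2 d + 1) / (2 d) of unknowns to
    equations keeps the solution exponential in [rho]. The quotients by [g] are bounded too, because
    the upper bound for P^[i](x1, x2) evaluates them at x2. *)
Lemma auxiliary_polynomial (g : {poly int}) d s M :
  g \is monic -> size g = d.+1 -> (0 < d)%N ->
  exists2 K, (0 < K)%N & forall rho, (0 < rho)%N ->
  exists p : 'I_s.+1 -> {poly int},
  [/\ forall l, (size (p l) <= (2 * d).+1 * rho)%N, exists l, p l != 0,
      forall l a, (`|((p l)`_a)%R| <= K ^ rho)%N &
      forall i, (i < 2 * (s.+1 * rho))%N -> exists2 q,
        \sum_l nderivn i (p l) * 'X^l = q * g &
        forall x : rat, `|x| <= M%:R -> `|(map_poly intr q).[x]| <= (K ^ rho)%:R].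
Proof.
move=> gm sg d0.
set b := coef_bound g; have b0 : (0 < b)%N by [].
set e := ((2 * d).+1 + s)%N.
pose n0 := (2 * (s.+1 * (2 * d).+1))%N; pose a0 := ((2 * (M + b)) ^ e)%N.
pose K1 := ((2 * (n0 * a0)) ^ (2 * d))%N.
have a00 : (0 < a0)%N by rewrite expn_gt0; lia.
have n00 : (0 < n0)%N by rewrite /n0; lia.
have K10 : (0 < K1)%N by rewrite expn_gt0; nia.
exists (n0 * K1 * a0)%N; first by move: (n0) (K1) (a0) n00 K10 a00 => x y z; nia.
move=> rho rho0; pose D := ((2 * d).+1 * rho)%N.
pose I := ('I_s.+1 * 'I_D)%type; pose J := ('I_(2 * (s.+1 * rho)) * 'I_d)%type.
(* Truncated subtraction is harmless: the binomial coefficient in [A] is 0 when [i] exceeds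
   [u.2]. *)
pose R (i : nat) (u : I) := (u.2 - i + u.1)%N.
pose A (j : J) (u : I) : int := (rem_exp g (R j.1 u))`_j.2 *+ 'C(u.2, j.1).
pose a := (a0 ^ rho)%N.
have RE (i : nat) (u : I) : (R i u <= e * rho)%N.
  rewrite /R; have := ltn_ord u.1; have := ltn_ord u.2; rewrite /D /e; nia.
have De : (D <= e * rho)%N by rewrite /D /e; nia.
have pow2 (u : I) i : ('C(u.2, i) <= 2 ^ (e * rho))%N.
  apply: leq_trans (bin_leq_exp2 _ _) _; rewrite leq_exp2l //.
  by apply: leq_trans De; apply: ltnW.
have aE : a = (2 ^ (e * rho) * (M + b) ^ (e * rho))%N.
  by rewrite /a /a0 -expnM expnMn.
have powb (i : nat) (u : I) : ((M + b) ^ (R i u) <= (M + b) ^ (e * rho))%N.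
  by rewrite leq_pexp2l ?RE //; lia.
have Aa j u : (`|A j u| <= a)%N.
  rewrite /A -mulr_natr abszM natz absz_nat aE mulnC leq_mul //.
  apply: leq_trans (coef_rem_exp _ _ _) _; apply: leq_trans (powb j.1 u).
  have [->//|r0] := posnP (R j.1 u).
  by rewrite leq_exp2r // leq_addl.
have cI : #|{: I}| = (s.+1 * D)%N by rewrite card_prod !card_ord.
have nI : (#|{: I}| <= n0 ^ rho)%N.
  rewrite cI /D; apply: (leq_trans (n := (s.+1 * (2 * d).+1 * 2 ^ rho)%N)).
    by rewrite mulnA leq_mul // ltnW // ltn_expl.
  rewrite /n0 expnMn mulnC leq_mul //.
  by rewrite -[leqLHS]expn1 leq_pexp2l.
(* The exponent [2 * d] is the number of equations divided by the excess of unknowns over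
   equations. *)
pose Z := (2 * (#|{: I}| * a))%N; pose X := (Z ^ (2 * d))%N.
have a_gt0 : (0 < a)%N by rewrite expn_gt0 a00.
have I0 : (0 < #|{: I}|)%N by rewrite cI muln_gt0 /D; nia.
have Z0 : (0 < Z)%N by rewrite /Z !muln_gt0 I0 a_gt0.
have XK : (X <= K1 ^ rho)%N.
  rewrite /X /K1 -expnM (mulnC _ rho) (expnM _ rho) leq_exp2r; last by lia.
  have r2 : (2 <= 2 ^ rho)%N by rewrite -[leqLHS]expn1 leq_pexp2l.
  by rewrite /Z (expnMn 2) (expnMn n0) leq_mul // leq_mul.
have hc : ((2 * (#|{: I}| * (a * X))).+1 ^ #|{: J}| < X.+1 ^ #|{: I}|)%N.
  rewrite cI card_prod !card_ord.
  have -> : (s.+1 * D = (2 * d).+1 * (s.+1 * rho))%N by rewrite /D; ring.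
  have -> : (2 * (s.+1 * rho) * d = (2 * d) * (s.+1 * rho))%N by ring.
  rewrite (expnM _ _ (s.+1 * rho)) (expnM X.+1 _ (s.+1 * rho)).
  rewrite ltn_exp2r; last by rewrite muln_gt0.
  apply: (@leq_ltn_trans ((Z * X.+1) ^ (2 * d))).
    rewrite leq_exp2r; last by lia.
    rewrite mulnS -add1n; apply: leq_add => //; apply: eq_leq.
    by rewrite /Z cI /D; ring.
  by rewrite expnMn -/X expnS ltn_mul2r ltnSn expn_gt0.
have [v [[u0 vu0] vX vA]] := siegel Aa hc.
pose p (l : 'I_s.+1) : {poly int} := \sum_(k < D) v (l, k) *: 'X^k.
have coefp l k : (p l)`_k = if insub k is Some k' then v (l, k') else 0.
  rewrite /p coef_sum; case: insubP => [k' _ <-|].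
    rewrite (bigD1 k') //= coefZ coefXn eqxx mulr1 big1 ?addr0 // => k2 nk.
    by rewrite coefZ coefXn eq_sym (inj_eq (@ord_inj _)) (negPf nk) mulr0.
  rewrite -leqNgt => Dk; rewrite big1 // => k' _; rewrite coefZ coefXn.
  by rewrite gtn_eqF ?mulr0 // (leq_trans (ltn_ord k')).
have XK' : (X <= (n0 * K1 * a0) ^ rho)%N.
  apply: leq_trans XK _; rewrite leq_exp2r //.
  by rewrite -[leqLHS]muln1 -[leqLHS]mul1n mulnA leq_mul // leq_mul.
exists p; split.
- move=> l; apply/leq_sizeP => k hk; rewrite coefp.
  by case: insubP => // k'; rewrite ltnNge hk.
- exists u0.1; apply: contra vu0 => /eqP/(congr1 (fun q : {poly int} => q`_u0.2)).
  by rewrite coefp valK coef0 -surjective_pairing => ->.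
- by move=> l k; rewrite coefp; case: insubP => [k' _ _|_] //; exact: leq_trans (vX _) XK'.
move=> i hi; pose w (u : I) := v u * ('C(u.2, i))%:Z.
exists (\sum_(u : I) (w u)%:P * quo_exp g (R i u)).
  transitivity (\sum_(u : I) (w u)%:P * 'X^(R i u)).
    rewrite /p /=; under eq_bigr => l _ do rewrite linear_sum big_distrl /=.
    rewrite pair_bigA /=; apply: eq_bigr => -[l k] _ /=.
    rewrite linearZ /= nderivnXn /w /R /= -mul_polyC exprD !polyCM.
    by rewrite -[in RHS]natz polyC_natr -mulr_natr; ring.
  under eq_bigr => u _ do rewrite (exp_quo_rem g) mulrDr mulrA.
  rewrite big_split big_distrl /= [X in _ + X](_ : _ = 0) ?addr0 //.
  apply/polyP => c; rewrite coef0 coef_sum.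
  case: (ltnP c d) => [cd|cd].
    rewrite -[RHS](vA (Ordinal hi, Ordinal cd)); apply: eq_bigr => u _.
    by rewrite coefCM /w /A /= -mulr_natr natz mulrC [in RHS]mulrC mulrCA; ring.
  apply: big1 => u _; rewrite coefCM nth_default ?mulr0 //.
  apply: leq_trans cd; rewrite -ltnS -sg; apply: size_rem_exp => //.
  by rewrite sg ltnS.
move=> x xM; rewrite rmorph_sum /= horner_sum.
apply: le_trans (ler_norm_sum _ _ _) _.
apply: (@le_trans _ _ (\sum_(u : I) (X * a)%:R)).
  apply: ler_sum => u _; rewrite rmorphM /= map_polyC hornerM hornerC /= normrM.
  rewrite normr_intr (le_trans (ler_wpM2l _ (quo_exp_bound _ _ xM))) //.
  rewrite -natrM ler_nat /w abszM absz_nat -mulnA leq_mul // aE leq_mul //.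
rewrite sumr_const -mulrnA ler_nat.
rewrite (expnMn (n0 * K1)) (expnMn n0) mulnC mulnA leq_mul // leq_mul //.
Qed.

Lemma dvdp_nderivn (F : fieldType) (S : {poly F}) a r :
  (forall i, (i < r)%N -> (nderivn i S).[a] = 0) -> ('X - a%:P) ^+ r %| S.
Proof.
move=> h; have -> : S = \sum_(i < size S) (nderivn i S).[a]%:P * ('X - a%:P) ^+ i.
  rewrite -[LHS]comp_polyXr /comp_poly -{1}(subrK a%:P 'X) [_ + a%:P]addrC.
  rewrite nderiv_taylor; last exact: mulrC.
  rewrite size_map_polyC; apply: eq_bigr => i _.
  by rewrite nderivn_map horner_map.
apply: (big_ind (fun q => _ %| q)) => [|u v hu hv|i _]; rewrite ?dvdp0 ?dvdp_add //.
case: (ltnP i r) => ir; first by rewrite h // mul0r dvdp0.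
by rewrite dvdp_mull // dvdp_exp2l.
Qed.

(** If all these values vanished, the zero estimate would fail at d + 1 points: (alpha, alpha) to
    order 2 (s + 1) rho for each root alpha of [g], and (x1, x2) to order (s + 1) rho + d s. The
    nodes are distinct because [g] is separable and x1, x2 are not roots. *)
Lemma auxiliary_nonvanishing (g : {poly int}) d s rho (p : 'I_s.+1 -> {poly int})
    (x1 x2 : rat) :
  g \is monic -> size g = d.+1 -> separable_poly (map_poly intr g : {poly rat}) ->
  (s < d)%N -> (d * s <= s.+1 * rho)%N -> (0 < rho)%N ->
  (forall l, (size (p l) <= (2 * d).+1 * rho)%N) -> (exists l, p l != 0) ->
  (forall i, (i < 2 * (s.+1 * rho))%N -> exists q,
        \sum_l nderivn i (p l) * 'X^l = q * g) ->
  (map_poly intr g).[x1] != 0 -> (map_poly intr g).[x2] != 0 ->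
  exists2 i, (i < s.+1 * rho + d * s)%N &
    \sum_l (map_poly intr (nderivn i (p l))).[x1] * x2 ^+ l != 0.
Proof.
move=> gm sg gsep sd dsr rho0 sp [l0 pl0] hq gx1 gx2.
set M := (s.+1 * rho + d * s)%N.
have [/existsP [i hi]|/existsPn hN] := boolP [exists i : 'I_M,
  \sum_l (map_poly intr (nderivn i (p l))).[x1] * x2 ^+ l != 0].
  by exists i => //.
exfalso.
pose gC : {poly algC} := map_poly intr g.
have gCE : gC = map_poly ratr (map_poly intr g : {poly rat}).
  by rewrite -map_poly_comp; apply: eq_map_poly => z /=; rewrite ratr_int.
have gCm : gC \is monic by exact: monic_map.
have [rs rsE] := closed_field_poly_normal gC.
rewrite (monicP gCm) scale1r in rsE.
have urs : uniq rs by rewrite -separable_prod_XsubC -rsE gCE separable_map.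
have srs : size rs = d.
  have := congr1 (fun q : {poly algC} => size q) rsE.
  by rewrite size_prod_XsubC size_map_inj_poly ?sg //; [case|exact: intr_inj].
have nrs x : (map_poly intr g).[x] != 0 -> ratr x \notin rs.
  rewrite -root_prod_XsubC -rsE /root gCE horner_map /= fmorph_eq0 //.
pose pC l : {poly algC} := map_poly intr (p l).
pose a (i : 'I_d.+1) := (rcons rs (ratr x1))`_i.
pose b (i : 'I_d.+1) := (rcons rs (ratr x2))`_i.
pose r (i : 'I_d.+1) := if (i < d)%N then (2 * (s.+1 * rho))%N else M.
have inj x : (map_poly intr g).[x] != 0 ->
    injective (fun i : 'I_d.+1 => (rcons rs (ratr x : algC))`_i).
  move=> gx i j /eqP; rewrite nth_uniq ?size_rcons ?srs //.
    by move=> /eqP/ord_inj.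
  by rewrite rcons_uniq urs nrs.
pose D := ((2 * d).+1 * rho).-1.
have DE : D.+1 = ((2 * d).+1 * rho)%N by rewrite prednK // muln_gt0.
have : (\sum_i r i <= s.+1 * D + d.+1 * s)%N.
  apply: (@zero_estimate _ s D d.+1 pC a b r).
  - by move=> l; rewrite DE (leq_trans _ (sp l)) // size_poly.
  - exists l0; rewrite -size_poly_eq0 size_map_inj_poly ?size_poly_eq0 //.
    exact: intr_inj.
  - exact: inj.
  - exact: inj.
  - move=> i; rewrite -ltnS DE /r /M; case: ifP => _; nia.
  - move=> i; apply: dvdp_nderivn => k; rewrite /r.
    rewrite linear_sum horner_sum.
    under eq_bigr => l _ do rewrite linearZ /= hornerZ nderivn_map mulrC.
    case: ifP => hid hk.
      have -> : a i = b i by rewrite /a /b !nth_rcons srs hid.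
      have [q hqk] := hq k hk.
      have : (map_poly intr (q * g)).[b i] = 0.
        have h0 : gC.[b i] = 0.
          by apply/rootP; rewrite rsE root_prod_XsubC /b nth_rcons srs hid mem_nth // srs.
        by rewrite rmorphM hornerM [X in _ * X]h0 mulr0.
      move=> h; rewrite -[RHS]h -hqk rmorph_sum horner_sum; apply: eq_bigr => l _.
      by rewrite rmorphM /= map_polyXn hornerM hornerXn.
    have -> : a i = ratr x1.
      by rewrite /a nth_rcons srs hid; have := ltn_ord i; rewrite ltnS leq_eqVlt hid orbF => ->.
    have -> : b i = ratr x2.
      by rewrite /b nth_rcons srs hid; have := ltn_ord i; rewrite ltnS leq_eqVlt hid orbF => ->.
    have /negPn/eqP/(congr1 (ratr : rat -> algC)) := hN (Ordinal hk).
    rewrite rmorph0 rmorph_sum => h; rewrite -[RHS]h; apply: eq_bigr => l _ /=.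
    rewrite rmorphM rmorphXn /=; congr (_ * _).
    rewrite -horner_map -map_poly_comp; congr (_.[_]).
    by apply: eq_map_poly => z /=; rewrite ratr_int.
rewrite big_ord_recr /= /r ltnn.
rewrite (eq_bigr (fun=> (2 * (s.+1 * rho))%N)); last by move=> i _ /=; rewrite ltn_ord.
(* The orders add up to [s.+1 * D.+1 + d * s], exactly one more than the permitted
   [s.+1 * D + d.+1 * s]. *)
rewrite sum_nat_const card_ord leqNgt => /negP; apply.
have : (s.+1 * D.+1 = s.+1 * ((2 * d).+1 * rho))%N by rewrite DE.
by rewrite /M; nia.
Qed.

(** * Two approximations *)

Lemma mul_bin_bin i j k :
  ('C(i + (j + k), i) * 'C(j + k, j) = 'C(i + j + k, i + j) * 'C(i + j, i))%N.
Proof.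
have f0 : (0 < i`! * (j`! * k`!))%N by rewrite !muln_gt0 !fact_gt0.
have h1 := bin_fact (leq_addr (j + k) i); have h2 := bin_fact (leq_addr k j).
have h3 := bin_fact (leq_addr k (i + j)); have h4 := bin_fact (leq_addr j i).
rewrite !addKn in h1 h2 h3 h4.
apply/eqP; rewrite -(eqn_pmul2r f0); apply/eqP.
transitivity ((i + (j + k))`!).
  by rewrite -h1 -h2; ring.
by rewrite addnA -h3 -h4; ring.
Qed.

Lemma nderivn_nderivn (R : nzRingType) (S : {poly R}) i j :
  nderivn j (nderivn i S) = nderivn (i + j) S *+ 'C(i + j, i).
Proof.
apply/polyP => k; rewrite coefMn !coef_nderivn addnA -!mulrnA.
by rewrite -addnA mul_bin_bin addnA.
Qed.

Lemma int_denq_horner (q : {poly int}) n (x : rat) : (size q <= n.+1)%N ->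
  (denq x)%:~R ^+ n * (map_poly intr q).[x] \is a Num.int.
Proof.
move=> qn; rewrite (@horner_coef_wide _ n.+1) ?(leq_trans (size_poly _ _)) //.
rewrite mulr_sumr rpred_sum // => i _; rewrite coef_map /= mulrCA rpredM ?intr_int //.
rewrite -{2}[x]divq_num_den -[X in _ ^+ X * _](subnK (ltn_ord i : (i <= n)%N)).
rewrite exprD -mulrA -exprMn mulrCA divff ?intr_eq0 ?denq_neq0 // mulr1.
by rewrite rpredM // rpredX // intr_int.
Qed.

Lemma leq_mul_exp c rho : (0 < rho)%N -> (c * rho <= (2 * c) ^ rho)%N.
Proof.
case: c => [|c] rho0; first by rewrite mul0n.
rewrite expnMn mulnC leq_mul //; first by rewrite ltnW // ltn_expl.
by rewrite -[leqLHS]expn1 leq_pexp2l.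
Qed.

Lemma leq_subn_of_double u v i j :
  (2 * u <= i + j)%N -> (i < u + v)%N -> (u - v <= j)%N.
Proof. lia. Qed.

(** For a suitable i0 below (s + 1) rho + d s, the number T = P^[i0](x1, x2) is nonzero and its
    denominator divides the product of the two denominator powers, which bounds |T| from below. The
    Taylor expansion in x1 - x2 around (x2, x2) bounds it from above. *)
Lemma thue_siegel_core (g : {poly int}) d s M :
  g \is monic -> size g = d.+1 -> separable_poly (map_poly intr g : {poly rat}) ->
  (s < d)%N -> (0 < M)%N ->
  exists2 K : nat, (0 < K)%N & forall rho (x1 x2 : rat), (0 < rho)%N ->
  `|x1| <= M%:R -> `|x2| <= M%:R -> `|x1 - x2| <= 1 ->
  (map_poly intr g).[x1] != 0 -> (map_poly intr g).[x2] != 0 ->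
  1 <= (denq x1)%:~R ^+ ((2 * d).+1 * rho) * (denq x2)%:~R ^+ s * K%:R ^+ rho *
       (`|(map_poly intr g).[x2]| + `|x1 - x2| ^+ (s.+1 * rho - d * s)).
Proof.
move=> gm sg gsep sd M0.
have d0 : (0 < d)%N by apply: leq_ltn_trans sd.
have [K0 K00 aux] := auxiliary_polynomial s M gm sg d0.
set c := (2 * d).+1.
pose Ky := (s.+1 * (2 * c) * K0 * 2 ^ c * M ^ (c + s))%N.
pose K := (2 * c * 2 ^ (2 * c) * Ky)%N.
have Ky0 : (0 < Ky)%N by rewrite /Ky !muln_gt0 !expn_gt0 K00 M0.
have K_gt0 : (0 < K)%N by rewrite /K muln_gt0 Ky0 muln_gt0 expn_gt0.
exists K => // rho x1 x2 rho0 x1M x2M x12 gx1 gx2.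
set e := (s.+1 * rho - d * s)%N; set G := `|_.[x2]|; set h := `|x1 - x2|.
have den1 (x : rat) n : 1 <= (denq x)%:~R ^+ n :> rat.
  by rewrite exprn_ege1 // ler1z -gtz0_ge1 denq_gt0.
have K1 : 1 <= K%:R ^+ rho :> rat by rewrite exprn_ege1 // ler1n.
(* When [d * s] is larger, the truncated exponent [e] is 0 and the right-hand side is at least 1. *)
case: (leqP (d * s) (s.+1 * rho)) => [dsr|/ltnW]; last first.
  rewrite -subn_eq0 -/e => /eqP ->; rewrite expr0.
  apply: (@le_trans _ _ (1 * 1 * 1 * 1)); first by rewrite !mulr1.
  by rewrite !ler_pM ?mulr_ge0 //; rewrite ler_wpDl /G.
have [p [sp pn0 pK pq]] := aux rho rho0.
have [i0 i0M T0] : exists2 i, (i < s.+1 * rho + d * s)%N &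
    \sum_l (map_poly intr (nderivn i (p l))).[x1] * x2 ^+ l != 0.
  apply: (auxiliary_nonvanishing gm sg gsep) => // i hi.
  by have [q hq _] := pq i hi; exists q.
set T := \sum_l _ in T0.
pose D := (c * rho)%N.
have i0D : (i0 <= D)%N.
  apply: leq_trans (ltnW i0M) _; apply: leq_trans (leq_add (leqnn _) dsr) _.
  by rewrite addnn -mul2n mulnA leq_mul // leqW // leq_mul2l.
have T1 : 1 <= (denq x1)%:~R ^+ D * (denq x2)%:~R ^+ s * `|T|.
  have Tint : (denq x1)%:~R ^+ D * (denq x2)%:~R ^+ s * T \is a Num.int.
    rewrite /T mulr_sumr rpred_sum // => l _; rewrite mulrACA rpredM //.
      apply: int_denq_horner; apply: leq_trans (leqW (sp l)).
      by rewrite (leq_trans (size_poly _ _)) // leq_subr.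
    have -> : x2 ^+ l = (map_poly intr ('X^l : {poly int})).[x2].
      by rewrite map_polyXn hornerXn.
    by apply: int_denq_horner; rewrite size_polyXn.
  have := norm_intr_ge1 Tint; rewrite normrM ger0_norm; last first.
    by rewrite mulr_ge0 // (le_trans ler01 (den1 _ _)).
  by apply; rewrite !mulf_neq0 // expf_neq0 // intr_eq0 denq_neq0.
pose S : {poly rat} := \sum_(l < s.+1) x2 ^+ l *: map_poly intr (p l).
have SE i x : (nderivn i S).[x] = \sum_l (map_poly intr (nderivn i (p l))).[x] * x2 ^+ l.
  rewrite /S linear_sum horner_sum; apply: eq_bigr => l _.
  by rewrite linearZ hornerZ /= nderivn_map mulrC.
have sS : (size S <= D)%N.
  apply: (leq_trans (size_sum _ _ _)); apply/bigmax_leqP => l _.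
  apply: (leq_trans (size_scale_leq _ _)); apply: leq_trans (sp l).
  exact: size_poly.
have M1 : 1 <= M%:R :> rat by rewrite ler1n.
pose Y := (s.+1 * (D * (K0 ^ rho * (2 ^ D * M ^ (D + s)))))%N.
have D0 : (0 < D)%N by rewrite muln_gt0.
have K0Y : (K0 ^ rho <= Y)%N.
  rewrite /Y mulnCA (mulnCA s.+1) (mulnCA D) -[leqLHS]muln1 leq_mul //.
  by rewrite muln_gt0 D0 !muln_gt0 !expn_gt0 M0.
have bnd k : `|(nderivn k S).[x2]| <= Y%:R.
  rewrite SE (le_trans (ler_norm_sum _ _ _)) //.
  apply: (@le_trans _ _ (\sum_(l < s.+1) (D * (K0 ^ rho * (2 ^ D * M ^ (D + s))))%:R)); last first.
    by rewrite sumr_const card_ord -mulrnA ler_nat mulnC.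
  apply: ler_sum => l _.
  rewrite (@horner_coef_wide _ D); last first.
    apply: leq_trans (sp l); apply: leq_trans (size_poly _ _) _.
    by apply: leq_trans (size_poly _ _) (leq_subr _ _).
  rewrite mulr_suml (le_trans (ler_norm_sum _ _ _)) //.
  apply: (@le_trans _ _ (\sum_(a < D) (K0 ^ rho * (2 ^ D * M ^ (D + s)))%:R)); last first.
    by rewrite sumr_const card_ord -mulrnA ler_nat mulnC.
  apply: ler_sum => a _; rewrite coef_map /= -mulrA -exprD normrM normr_intr.
  have hC : (`|((nderivn k (p l))`_a)%R| <= K0 ^ rho * 2 ^ D)%N.
    rewrite coef_nderivn; case: (ltnP (k + a) D) => kaD; last first.
      have -> : (p l)`_(k + a) = 0 by apply: nth_default; exact: leq_trans (sp l) kaD.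
      by rewrite mul0rn.
    rewrite -mulr_natr abszM natz absz_nat leq_mul ?pK //.
    by rewrite (leq_trans (bin_leq_exp2 _ _)) // leq_exp2l // ltnW.
  rewrite mulnA natrM ler_pM ?ler_nat // normrX.
  rewrite (@le_trans _ _ (M%:R ^+ (a + l))) ?lerXn2r ?nnegrE //.
  rewrite -natrX ler_nat leq_pexp2l // leq_add //; first exact: ltnW.
  by rewrite -ltnS.
have Tbnd : `|T| <= (D * (2 ^ (2 * D) * Y))%:R * (G + h ^+ e).
  have -> : T = (nderivn i0 S).[x2 + (x1 - x2)] by rewrite SE addrC subrK.
  rewrite (@nderiv_taylor_wide _ D); last 2 first.
  - exact: mulrC.
  - by apply: leq_trans sS; apply: leq_trans (size_poly _ _) (leq_subr _ _).
  rewrite (le_trans (ler_norm_sum _ _ _)) //.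
  apply: (@le_trans _ _ (\sum_(i < D) (2 ^ (2 * D) * Y)%:R * (G + h ^+ e))); last first.
    by rewrite -mulr_suml sumr_const card_ord -mulrnA mulnC.
  apply: ler_sum => i _; rewrite nderivn_nderivn hornerMn -mulr_natr.
  rewrite mulrAC mulrC normrM normr_nat natrM -mulrA ler_pM //.
    rewrite ler_nat (leq_trans (bin_leq_exp2 _ _)) // leq_exp2l //.
    by rewrite mul2n -addnn leq_add ?(ltnW (ltn_ord i)).
  rewrite normrM normrX -/h.
  have h0 : 0 <= h by rewrite /h.
  have G0 : 0 <= G by rewrite /G.
  (* Derivatives of low order carry the factor g(x2) by construction; for the others [i] is at least
     [e], because [i0] is below (s + 1) rho + d s. *)
  case: (ltnP (i0 + i) (2 * (s.+1 * rho))) => ir.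
    have [q hq qb] := pq _ ir.
    have -> : (nderivn (i0 + i) S).[x2] = (map_poly intr (q * g)).[x2].
      rewrite SE -hq rmorph_sum horner_sum; apply: eq_bigr => l _.
      by rewrite rmorphM /= map_polyXn hornerM hornerXn.
    rewrite rmorphM hornerM normrM -/G.
    rewrite -mulrA ler_pM ?mulr_ge0 ?exprn_ge0 //.
      by rewrite (le_trans (qb _ x2M)) // ler_nat.
    rewrite (@le_trans _ _ (G * 1)) ?ler_wpM2l ?exprn_ile1 //.
    by rewrite mulr1 lerDl exprn_ge0.
  rewrite ler_pM ?exprn_ge0 //.
  rewrite (@le_trans _ _ (h ^+ e)) ?lerDr //.
  by rewrite ler_wiXn2l //; exact: leq_subn_of_double ir i0M.
have DYK : (D * (2 ^ (2 * D) * Y) <= K ^ rho)%N.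
  have e1 : (D <= (2 * c) ^ rho)%N by exact: leq_mul_exp.
  have e2 : (s.+1 <= s.+1 ^ rho)%N by rewrite -[leqLHS]expn1 leq_pexp2l.
  have e3 : (M ^ (D + s) <= (M ^ (c + s)) ^ rho)%N.
    by rewrite -expnM leq_pexp2l // /D mulnDl leq_add // leq_pmulr.
  have e4 : (2 ^ D = (2 ^ c) ^ rho)%N by rewrite /D expnM.
  have e5 : (2 ^ (2 * D) = (2 ^ (2 * c)) ^ rho)%N by rewrite /D mulnA expnM.
  have -> : (K ^ rho = (2 * c) ^ rho * ((2 ^ (2 * c)) ^ rho *
     (s.+1 ^ rho * ((2 * c) ^ rho * (K0 ^ rho * ((2 ^ c) ^ rho * (M ^ (c + s)) ^ rho))))))%N.
    by rewrite -!expnMn /K /Ky; congr (_ ^ _)%N; ring.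
  by rewrite /Y e4 e5 !leq_mul.
apply: le_trans T1 _; rewrite -!mulrA ler_wpM2l ?(le_trans ler01 (den1 _ _)) //.
rewrite ler_wpM2l ?(le_trans ler01 (den1 _ _)) //.
apply: le_trans Tbnd _; rewrite ler_wpM2r ?addr_ge0 ?exprn_ge0 /G /h //.
by rewrite -natrX ler_nat.
Qed.

(** * Infinite families of good approximations *)

Definition unbounded (P : nat -> Prop) := forall K, exists2 n, (K <= n)%N & P n.

Lemma unbounded_color (P : nat -> Prop) N (f : nat -> 'I_N) : unbounded P ->
  exists i, unbounded (fun n => P n /\ f n = i).
Proof.
move=> hP; apply: contrapT => h.
have {}h i : exists K, forall n, (K <= n)%N -> P n -> f n <> i.
  apply: contrapT => hi; apply: h; exists i => K.
  apply: contrapT => hK; apply: hi; exists K => n Kn Pn fn.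
  by apply: hK; exists n.
have /fin_all_exists [K hK] := h.
have [n Kn Pn] := hP (\max_i K i)%N.
by apply: (hK (f n) n) => //; apply: leq_trans Kn; exact: leq_bigmax.
Qed.

(** Cutting [-M, M] into finitely many cells of length [eta] replaces compactness, so no limit point
    is needed. *)
Lemma unbounded_close (P : nat -> Prop) (X : nat -> rat) (M eta : rat) :
  0 < eta -> (forall n, P n -> `|X n| <= M) -> unbounded P ->
  exists Q : nat -> Prop, [/\ unbounded Q, forall n, Q n -> P n &
    forall m n, Q m -> Q n -> `|X m - X n| <= eta].
Proof.
move=> eta0 XM hP.
pose u n := (X n + M) / eta.
pose N := (Num.truncn (2 * M / eta)).+1.
have u0 n : P n -> 0 <= u n.
  move=> /XM; rewrite ler_norml => /andP[h _]; rewrite divr_ge0 ?(ltW eta0) //.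
  by rewrite -lerBlDr sub0r.
have uN n : P n -> (Num.truncn (u n) < N)%N.
  move=> Pn; rewrite ltnS; apply: le_truncn.
  rewrite ler_pM2r ?invr_gt0 //; have := XM n Pn; rewrite ler_norml => /andP[_]; lra.
pose f n : 'I_N := inord (Num.truncn (u n)).
have [i hi] := unbounded_color f hP.
exists (fun n => P n /\ f n = i); split => // [n []//|m n [Pm fm] [Pn fn]].
have : Num.truncn (u m) = Num.truncn (u n).
  have := congr1 val (etrans fm (esym fn)); rewrite /= !inordK //; exact: uN.
have := truncn_itv (u0 m Pm); have := truncn_itv (u0 n Pn).
move=> /andP[h1 h2] /andP[h3 h4] e; rewrite e in h3 h4.
have -> : X m - X n = (u m - u n) * eta.
  by rewrite /u -mulrBl divfK ?gt_eqF //; ring.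
rewrite normrM (gtr0_norm eta0) ler_piMl ?(ltW eta0) // ler_norml.
by rewrite -natr1 in h2 h4; apply/andP; split; lra.
Qed.

Lemma poly_bounded (p : {poly rat}) (M : rat) : 0 <= M ->
  exists2 C, 0 < C & forall x, `|x| <= M -> `|p.[x]| <= C.
Proof.
move=> M0; exists (\sum_(i < size p) `|p`_i| * M ^+ i + 1).
  by rewrite ltr_wpDl // sumr_ge0 // => i _; rewrite mulr_ge0 // exprn_ge0.
move=> x xM; rewrite horner_coef (le_trans (ler_norm_sum _ _ _)) //.
rewrite ler_wpDr // ler_sum // => i _; rewrite normrM normrX ler_wpM2l //.
by rewrite lerXn2r ?nnegrE.
Qed.

(* Where [g] is small, [g'] is bounded below by a Bezout relation, so [g] is
   locally bi-Lipschitz there. *)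
Lemma separable_close (g : {poly rat}) (M : rat) : separable_poly g -> 0 <= M ->
  exists eta del C, [/\ 0 < eta, 0 < del, 0 < C &
    forall x y, `|x| <= M -> `|x - y| <= eta -> `|g.[x]| <= del ->
      `|x - y| <= C * (`|g.[x]| + `|g.[y]|)].
Proof.
rewrite separable_poly.unlock => /Bezout_eq1_coprimepP [[u v] /= huv] M0.
have [Cu Cu0 hu] := poly_bounded u M0; have [Cv Cv0 hv] := poly_bounded v M0.
have [Ct [Ct0 ht]] : exists Ct, 0 < Ct /\ forall x h, `|x| <= M -> `|h| <= 1 ->
    `|g.[x + h] - g.[x] - (deriv g).[x] * h| <= Ct * h ^+ 2.
  have /fin_all_exists2 [Cn Cn0 hn] (i : 'I_(size g)) := poly_bounded (nderivn i.+2 g) M0.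
  exists (\sum_i Cn i + 1); split.
    by rewrite ltr_wpDl // sumr_ge0 // => i _; rewrite ltW.
  move=> x h xM h1; have h20 : 0 <= h ^+ 2 by exact: sqr_ge0.
  rewrite (@nderiv_taylor_wide _ (size g).+2); [|exact: mulrC|by rewrite -addn2 leq_addr].
  rewrite !big_ord_recl /= nderivn0 nderivn1 expr0 mulr1 expr1.
  set S := \sum_(_ < _) _.
  have -> : g.[x] + ((deriv g).[x] * h + S) - g.[x] - (deriv g).[x] * h = S by ring.
  rewrite /S (le_trans (ler_norm_sum _ _ _)) // mulrDl mul1r ler_wpDr // mulr_suml.
  apply: ler_sum => i _; rewrite /bump /= !add1n normrM ler_pM ?hn //.
  by rewrite -[leRHS]ger0_norm // !normrX ler_wiXn2l.
pose B := (2 * Cv)^-1; have B0 : 0 < B by rewrite invr_gt0 mulr_gt0.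
have g'big x : `|x| <= M -> `|g.[x]| <= (2 * Cu)^-1 -> B <= `|(deriv g).[x]|.
  move=> xM gx; have := congr1 (fun p => p.[x]) huv.
  rewrite hornerD !hornerM hornerC => e.
  have h1 : 1 <= `|u.[x]| * `|g.[x]| + `|v.[x]| * `|(deriv g).[x]|.
    by rewrite -!normrM (le_trans _ (ler_normD _ _)) // e normr1.
  have h2 : `|u.[x]| * `|g.[x]| <= 2^-1.
    apply: le_trans (ler_pM _ _ (hu x xM) gx) _ => //.
    by rewrite invfM mulrCA divff ?gt_eqF // mulr1.
  have h3 : `|v.[x]| * `|(deriv g).[x]| <= Cv * `|(deriv g).[x]|.
    by rewrite ler_wpM2r // hv.
  rewrite /B invfM -ler_pdivlMr ?invr_gt0 // invrK mulrC.
  by move: h1 h2 h3; lra.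
exists (Num.min 1 (B / (2 * Ct))), (2 * Cu)^-1, (2 / B); split.
- by rewrite lt_min ltr01 divr_gt0 // mulr_gt0.
- by rewrite invr_gt0 mulr_gt0.
- by rewrite divr_gt0.
move=> x y xM; rewrite le_min => /andP[xy1 xyB] gx.
have gb := g'big x xM gx.
have yE : x + (y - x) = y by ring.
have := ht x (y - x) xM; rewrite yE distrC => /(_ xy1) h.
set w := `|x - y|; have w0 : 0 <= w by exact: normr_ge0.
have wE : `|y - x| = w by rewrite distrC.
have h2 : `|(deriv g).[x] * (y - x)| <= `|g.[x]| + `|g.[y]| + Ct * w ^+ 2.
  have -> : w ^+ 2 = (y - x) ^+ 2 by rewrite -wE real_normK ?num_real.
  set r := g.[y] - g.[x] - _ in h.
  have -> : (deriv g).[x] * (y - x) = (g.[y] - g.[x]) - r by rewrite /r; ring.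
  rewrite (le_trans (ler_normB _ _)) //; have := ler_normB g.[y] g.[x].
  by move: h; lra.
rewrite normrM wE in h2.
have h3 : B * w <= `|(deriv g).[x]| * w by rewrite ler_wpM2r.
have h4 : Ct * w ^+ 2 <= B / 2 * w.
  rewrite expr2 mulrA ler_wpM2r //.
  have -> : B / 2 = Ct * (B / (2 * Ct)) by field; rewrite gt_eqF.
  by rewrite ler_wpM2l // ltW.
rewrite -[2 / B]invf_div ler_pdivlMl ?divr_gt0 //.
by move: h2 h3 h4; lra.
Qed.

Lemma exp_unbounded (t A : rat) : 1 < t -> exists n, A <= t ^+ n.
Proof.
move=> t1; have d0 : 0 < t - 1 by rewrite subr_gt0.
have bern n : 1 + n%:R * (t - 1) <= t ^+ n.
  elim: n => [|n IH]; first by rewrite mul0r addr0 expr0.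
  rewrite exprS -natr1; have h := ler_wpM2l (ltW (lt_trans ltr01 t1)) IH.
  apply: le_trans h; have : 0 <= n%:R * (t - 1) ^+ 2 by rewrite mulr_ge0 // sqr_ge0.
  by rewrite -subr_ge0; move/le_trans; apply; rewrite le_eqVlt; apply/orP; left; apply/eqP; ring.
exists (Num.truncn (`|A| / (t - 1))).+1; apply: le_trans (bern _).
have : 0 <= `|A| / (t - 1) by rewrite divr_ge0 // ltW.
move=> /truncn_itv/andP[_ h]; rewrite ltr_pdivrMr // in h.
by have := ler_norm A; move: h; lra.
Qed.

Lemma exp_exp4_unbounded (t A : rat) : 1 < t -> exists n0, forall n, (n0 <= n)%N ->
  A <= t ^+ (4 ^ n).
Proof.
move=> t1; have [m hm] := exp_unbounded A t1; exists m => n mn.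
apply: le_trans hm _; rewrite ler_eXn2l //.
by rewrite (leq_trans mn) // ltnW // ltn_expl.
Qed.

(** Take n1, then a much larger n2, and rho with (s + 1) rho 4^n1 = 4^n2, possible because s + 1 is
    a power of 4. In the squared inequality of [thue_siegel_core] the two denominators and the
    constants cost at most tau^(4^n2) each, while the smallness of [g] gains tau^(4 * 4^n2), up to a
    loss depending on n1 only. *)
Lemma thue_siegel_sequence (g : {poly int}) d b M (B : nat) (tau C : rat)
    (X : nat -> rat) :
  let s := (4 ^ b).-1 in
  g \is monic -> size g = d.+1 -> separable_poly (map_poly intr g : {poly rat}) ->
  (s < d)%N -> (0 < M)%N -> (0 < B)%N -> 1 < tau ->
  B%:R ^+ (6 * d) <= tau ^+ (4 ^ b) -> B%:R ^+ (2 * s) <= tau ->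
  (forall n, (denq (X n))%:~R <= B%:R ^+ (4 ^ n) :> rat) ->
  ~ unbounded (fun n => [/\ `|X n| <= M%:R, (map_poly intr g).[X n] != 0 &
      `|(map_poly intr g).[X n]| ^+ 2 * tau ^+ (4 * 4 ^ n) <= C]).
Proof.
move=> s gm sg gsep sd M0 B0 tau1 hB1 hB2 hden ub.
set gq : {poly rat} := map_poly intr g in gsep ub.
have tau0 : 0 < tau by exact: lt_trans tau1.
have sE : s.+1 = (4 ^ b)%N by rewrite /s prednK // expn_gt0.
have [K K0 TS] := thue_siegel_core gm sg gsep sd M0.
have [eta [del [Cc [eta0 del0 Cc0 hclose]]]] := separable_close gsep (ler0n _ M).
pose eta1 := Num.min 1 eta; have eta10 : 0 < eta1 by rewrite lt_min ltr01.
have [Q [ubQ QP Qclose]] :=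
  unbounded_close (P := fun n => [/\ `|X n| <= M%:R, gq.[X n] != 0 &
      `|gq.[X n]| ^+ 2 * tau ^+ (4 * 4 ^ n) <= C]) eta10
    (fun n (h : [/\ _, _ & _]) => let: And3 h _ _ := h in h) ub.
pose C1 := Num.max 1 (Num.max C (4 * Cc ^+ 2 * C)).
have C11 : 1 <= C1 by rewrite le_max lexx.
have C10 : 0 <= C1 := le_trans ler01 C11.
have C1C : C <= C1 by rewrite !le_max lexx orbT.
have C1C' : 4 * Cc ^+ 2 * C <= C1 by rewrite !le_max lexx !orbT.
(* The constants of the squared inequality are at most [K2 ^+ rho]; [n1] is taken so large that [K2]
   is below tau^(4^n1). *)
pose K2 := 4 * K%:R ^+ 2 * C1 ^+ s.+1.
have [N1 hN1] := exp_exp4_unbounded (Num.max K2 (C / del ^+ 2)) tau1.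
have [n1 n1N Q1] := ubQ N1.
have [x1M gx1 g1] := QP _ Q1.
have := hN1 _ n1N; rewrite ge_max => /andP[hK2 hdel].
set q1 := (4 ^ n1)%N in g1 hK2 hdel; have q10 : (0 < q1)%N by rewrite expn_gt0.
(* The last summand ensures 4^n2 > 4 q1 d s, which outweighs the loss of [d * s] in the exponent
   [e]. *)
have [n2 n2N Q2] := ubQ (n1 + b + (4 * q1 * d * s))%N.
have [x2M gx2 g2] := QP _ Q2.
set q2 := (4 ^ n2)%N in g2.
have n12 : (n1 + b <= n2)%N by apply: leq_trans n2N; rewrite leq_addr.
pose rho := (4 ^ (n2 - (n1 + b)))%N.
have rho0 : (0 < rho)%N by rewrite expn_gt0.
have q2E : (s.+1 * rho * q1 = q2)%N.
  rewrite sE /rho /q1 /q2 -!expnD; congr (4 ^ _)%N.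
  by move: n12; clear; lia.
have q2big : (4 * q1 * d * s < q2)%N.
  rewrite /q2 (leq_ltn_trans _ (ltn_expl n2 (isT : 1 < 4)%N)) //.
  by apply: leq_trans n2N; rewrite leq_addl.
have q12 : (q1 <= q2)%N by rewrite -q2E leq_pmull // muln_gt0.
set h := `|X n1 - X n2|; set G := `|gq.[X n2]|.
have := Qclose _ _ Q1 Q2; rewrite le_min => /andP[h1 heta].
have tp k : 0 < tau ^+ k by rewrite exprn_gt0.
have t1 k : 1 <= tau ^+ k by rewrite exprn_ege1 // ltW.
have G1del : `|gq.[X n1]| <= del.
  rewrite -(@ler_pXn2r _ 2) ?nnegrE ?(ltW del0) //.
  rewrite -(ler_pM2r (tp (4 * q1)%N)) (le_trans g1) //.
  rewrite mulrC -ler_pdivrMr ?exprn_gt0 // (le_trans hdel) //.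
  by rewrite ler_eXn2l // leq_pmull.
have hh : h ^+ 2 * tau ^+ (4 * q1) <= C1.
  have hb := hclose _ _ x1M heta G1del; rewrite -/h -/G in hb.
  apply: le_trans C1C'.
  have -> : 4 * Cc ^+ 2 * C = Cc ^+ 2 * (2 * (C + C)) by ring.
  have g2' : G ^+ 2 * tau ^+ (4 * q1) <= C.
    apply: le_trans g2; rewrite ler_wpM2l ?sqr_ge0 // ler_eXn2l //.
    by rewrite leq_mul2l q12 orbT.
  have : h ^+ 2 <= Cc ^+ 2 * (2 * (`|gq.[X n1]| ^+ 2 + G ^+ 2)).
    apply: (@le_trans _ _ ((Cc * (`|gq.[X n1]| + G)) ^+ 2)).
      by rewrite lerXn2r ?nnegrE ?mulr_ge0 ?addr_ge0 ?(ltW Cc0) ?normr_ge0.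
    rewrite exprMn ler_wpM2l ?sqr_ge0 //.
    by rewrite -subr_ge0 (_ : _ - _ = (`|gq.[X n1]| - G) ^+ 2) ?sqr_ge0 //; ring.
  move=> /(ler_wpM2r (ltW (tp (4 * q1)%N))) hb2; apply: le_trans hb2 _.
  rewrite -mulrA ler_wpM2l ?sqr_ge0 // -mulrA ler_wpM2l // mulrDl lerD //.
have := TS rho (X n1) (X n2) rho0 x1M x2M h1 gx1 gx2.
rewrite -/gq -/h -/G; set e := (s.+1 * rho - d * s)%N => main.
have G0 : 0 <= G by exact: normr_ge0.
have h0 : 0 <= h by exact: normr_ge0.
have dq0 n : 0 <= (denq (X n))%:~R :> rat by rewrite ler0z ltW // denq_gt0.
have main2 : 1 <= (denq (X n1))%:~R ^+ (2 * ((2 * d).+1 * rho)) *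
    (denq (X n2))%:~R ^+ (2 * s) * K%:R ^+ (2 * rho) * (2 * (G ^+ 2 + (h ^+ 2) ^+ e)).
  have m2 := exprn_ege1 2 main; apply: le_trans m2 _.
  rewrite !exprMn -!exprM !(mulnC _ 2) ler_wpM2l //.
    by rewrite !mulr_ge0 // exprn_ge0 // ler0z ltW // denq_gt0.
  rewrite -subr_ge0 (_ : _ - _ = (G - h ^+ e) ^+ 2) ?sqr_ge0 //; ring.
have d6 : (2 * (2 * d).+1 <= 6 * d)%N by move: sd; clear; lia.
have d1 : (denq (X n1))%:~R ^+ (2 * ((2 * d).+1 * rho)) <= tau ^+ q2.
  apply: (@le_trans _ _ ((B%:R ^+ q1) ^+ (6 * d * rho))).
    apply: (@le_trans _ _ ((B%:R ^+ q1) ^+ (2 * ((2 * d).+1 * rho)))).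
      by rewrite lerXn2r ?nnegrE ?exprn_ge0 ?dq0 // hden.
    rewrite ler_weXn2l ?exprn_ege1 ?ler1n //.
    by rewrite mulnA leq_mul2r d6 orbT.
  have -> : (B%:R ^+ q1) ^+ (6 * d * rho) = (B%:R ^+ (6 * d)) ^+ (rho * q1) :> rat.
    by rewrite -!exprM; congr (_ ^+ _); ring.
  have -> : tau ^+ q2 = (tau ^+ (4 ^ b)) ^+ (rho * q1).
    by rewrite -exprM -sE mulnA q2E.
  by rewrite lerXn2r ?nnegrE ?exprn_ge0 // ltW.
have d2 : (denq (X n2))%:~R ^+ (2 * s) <= tau ^+ q2.
  apply: (@le_trans _ _ ((B%:R ^+ q2) ^+ (2 * s))).
    by rewrite lerXn2r ?nnegrE ?exprn_ge0 ?dq0 // hden.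
  rewrite -exprM mulnC exprM lerXn2r ?nnegrE ?exprn_ge0 ?(ltW tau0) //.
have d3 : (G ^+ 2 + (h ^+ 2) ^+ e) * tau ^+ (4 * q2) <=
    2 * C1 ^+ (s.+1 * rho) * tau ^+ (4 * q1 * (d * s)).
  have p1 : C1 <= C1 ^+ (s.+1 * rho) * tau ^+ (4 * q1 * (d * s)).
    rewrite -[leLHS]mulr1 ler_pM ?ler01 ?C10 //.
    by rewrite -[leLHS]expr1 ler_weXn2l // muln_gt0.
  have p2 : (h ^+ 2) ^+ e * tau ^+ (4 * q2) <=
      C1 ^+ (s.+1 * rho) * tau ^+ (4 * q1 * (d * s)).
    move: (h ^+ 2) (sqr_ge0 h) hh => z z0 hz.
    apply: (@le_trans _ _ ((z * tau ^+ (4 * q1)) ^+ e * tau ^+ (4 * q1 * (d * s)))).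
      rewrite exprMn -mulrA ler_wpM2l ?exprn_ge0 // -exprM -exprD ler_eXn2l //.
      rewrite -mulnDr -q2E (mulnC _ q1) mulnA leq_mul2l; apply/orP; right.
      by rewrite /e addnC -leq_subLR.
    rewrite ler_wpM2r ?(ltW (tp _)) //.
    apply: (@le_trans _ _ (C1 ^+ e)).
      by rewrite lerXn2r ?nnegrE ?mulr_ge0 ?(ltW (tp _)) ?C10.
    by rewrite ler_weXn2l // leq_subr.
  rewrite mulrDl; have g2' := le_trans (le_trans g2 C1C) p1.
  by move: p2 g2'; rewrite -/G -/q2; lra.
have d4 : K%:R ^+ (2 * rho) * (4 * C1 ^+ (s.+1 * rho)) <= tau ^+ q2.
  apply: (@le_trans _ _ (K2 ^+ rho)).
    have -> : K2 ^+ rho = 4 ^+ rho * (K%:R ^+ (2 * rho) * C1 ^+ (s.+1 * rho)).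
      by rewrite /K2 exprMn exprMn -!exprM mulrA.
    rewrite mulrCA ler_wpM2r //.
      by rewrite mulr_ge0 ?exprn_ge0 ?C10.
    by rewrite -[leLHS]expr1 ler_weXn2l // ler1n.
  have -> : tau ^+ q2 = (tau ^+ (s.+1 * q1)) ^+ rho.
    by rewrite -exprM -q2E; congr (_ ^+ _); ring.
  rewrite lerXn2r ?nnegrE ?(ltW (tp _)) //.
    by rewrite !mulr_ge0 ?exprn_ge0 ?C10.
  by rewrite (le_trans hK2) // ler_eXn2l // leq_pmull.
have : tau ^+ (4 * q2) <= tau ^+ (3 * q2 + 4 * q1 * (d * s)).
  apply: (@le_trans _ _ (tau ^+ q2 * tau ^+ q2 *
     (K%:R ^+ (2 * rho) * (2 * (2 * C1 ^+ (s.+1 * rho) * tau ^+ (4 * q1 * (d * s))))))).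
    have step := ler_wpM2r (ltW (tp (4 * q2)%N)) main2; rewrite mul1r in step.
    apply: le_trans step _; rewrite -(mulrA _ (2 * _)) -(mulrA _ (K%:R ^+ _)).
    rewrite -(mulrA 2); apply: ler_pM.
    - by rewrite mulr_ge0 // exprn_ge0.
    - by rewrite !mulr_ge0 ?addr_ge0 ?exprn_ge0 ?(ltW tau0).
    - by rewrite ler_pM ?exprn_ge0.
    by rewrite ler_wpM2l ?exprn_ge0 // ler_wpM2l.
  have -> : tau ^+ (3 * q2 + 4 * q1 * (d * s)) =
      tau ^+ q2 * tau ^+ q2 * (tau ^+ q2 * tau ^+ (4 * q1 * (d * s))).
    by rewrite -!exprD; congr (_ ^+ _); ring.
  rewrite ler_wpM2l ?mulr_ge0 ?(ltW (tp _)) //.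
  have -> (u v w : rat) : u * (2 * (2 * v * w)) = u * (4 * v) * w by ring.
  by rewrite ler_wpM2r // ltW.
rewrite ler_eXn2l // (mulSnr 3 q2) leq_add2l leqNgt mulnA q2big.
by [].
Qed.

(** * Duplication on the curve *)

Definition opp_point (Q : ec_point) : ec_point :=
  if Q is Affine x y then Affine x (- y) else Infinity.

Lemma opp_pointK : involutive opp_point.
Proof. by case=> //= x y; rewrite opprK. Qed.

Lemma opp_point_inj : injective opp_point.
Proof. exact: inv_inj opp_pointK. Qed.

Lemma on_curve_opp E Q : on_curve E Q -> on_curve E (opp_point Q).
Proof. by case: Q => //= x y; rewrite sqrrN. Qed.

Lemma add_pointC E P Q : on_curve E P -> on_curve E Q ->
  add_point E P Q = add_point E Q P.
Proof.
case: P => [|x1 y1]; case: Q => [|x2 y2] //= h1 h2.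
rewrite [x2 == x1]eq_sym (eq_sym y2) -[- y1 == y2]eqr_opp opprK.
have [ex|nx] /= := eqVneq x1 x2.
  subst x2; have [//|ny] := eqVneq y1 (- y2).
  have ey : y1 = y2.
    move/eqP: h1; rewrite -h2 -subr_eq0 subr_sqr mulf_eq0 subr_eq0 addr_eq0.
    by rewrite (negPf ny) orbF => /eqP.
  by rewrite ey.
have nx' : x2 - x1 != 0 by rewrite subr_eq0 eq_sym.
have nx2 : x1 - x2 != 0 by rewrite subr_eq0.
by rewrite /slope (negPf nx) eq_sym (negPf nx); congr Affine; field; rewrite nx' nx2.
Qed.

Lemma add_point_opp E Q : add_point E Q (opp_point Q) = Infinity.
Proof. by case: Q => //= x y; rewrite opprK !eqxx. Qed.

Lemma add_point0 E Q : add_point E Q Infinity = Q.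
Proof. by case: Q. Qed.

Lemma add_opp_opp E P Q :
  add_point E (opp_point P) (opp_point Q) = opp_point (add_point E P Q).
Proof.
case: P => [|x1 y1] //; case: Q => [|x2 y2] //=.
rewrite eqr_opp; case: ifP => //= _; rewrite /slope.
have -> : (if x1 == x2 then (deriv (cubic_poly rat E)).[x1] / (2 * - y1)
   else (- y2 - - y1) / (x2 - x1)) = - (if x1 == x2
   then (deriv (cubic_poly rat E)).[x1] / (2 * y1) else (y2 - y1) / (x2 - x1)).
  by case: ifP => _; [rewrite mulrN invrN mulrN | rewrite -mulNr opprD].
by rewrite sqrrN; congr Affine; ring.
Qed.

Definition x_coord (Q : ec_point) : rat := if Q is Affine x _ then x else 0.
Definition y_coord (Q : ec_point) : rat := if Q is Affine _ y then y else 0.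

(* The line through [P] and [Q] passes through [- (P + Q)]. *)
Lemma add_pointK E P Q : P <> Infinity -> Q <> Infinity ->
  on_curve E P -> on_curve E Q -> add_point E P Q <> Infinity ->
  x_coord (add_point E P Q) != x_coord P ->
  add_point E (add_point E P Q) (opp_point P) = Q.
Proof.
case: P => [|u v] //; case: Q => [|x y] // _ _ /= hP hQ.
case: ifP => //= hopp _; set s := slope _ _ _ _ _; set x3 := s ^+ 2 - _ - _ - _.
move=> nx; rewrite (negPf nx) /=.
have nx' : u - x3 != 0 by rewrite subr_eq0 eq_sym.
have -> : slope E x3 (s * (u - x3) - v) u (- v) = - s.
  by rewrite /slope (negPf nx); field.
have hy : s * (x - u) = y - v.
  rewrite /s /slope; move: hopp; have [eux|nux] /= := eqVneq u x; last first.
    by move=> _; rewrite divfK // subr_eq0 eq_sym.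
  move: hQ; rewrite -eux -hP => /eqP; rewrite -subr_eq0 subr_sqr mulf_eq0.
  rewrite subr_eq0 addr_eq0 => /orP[/eqP ->|/eqP ->]; first by rewrite !subrr mulr0.
  by rewrite opprK eqxx.
congr Affine; first by rewrite /x3; ring.
have -> : y = v + s * (x - u) by rewrite hy; ring.
by rewrite /x3; ring.
Qed.

Definition double_x (K : fieldType) (E : cubic) (x : K) : K :=
  let a := (coef_a E)%:~R in let b := (coef_b E)%:~R in let c := (coef_c E)%:~R in
  (x ^+ 4 - 2 * b * x ^+ 2 - 8 * c * x + (b ^+ 2 - 4 * a * c)) /
  (4 * (x ^+ 3 + a * x ^+ 2 + b * x + c)).

Lemma add_point_chord E x1 y1 x2 y2 : x1 != x2 ->
  add_point E (Affine x1 y1) (Affine x2 y2) =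
  let s := (y2 - y1) / (x2 - x1) in
  let x3 := s ^+ 2 - (coef_a E)%:~R - x1 - x2 in Affine x3 (s * (x1 - x3) - y1).
Proof. by move=> /negPf h; rewrite /= /slope h. Qed.

Lemma add_point_tangent E x y : y != 0 ->
  add_point E (Affine x y) (Affine x y) =
  let s := (3 * x ^+ 2 + 2 * (coef_a E)%:~R * x + (coef_b E)%:~R) / (2 * y) in
  let x3 := s ^+ 2 - (coef_a E)%:~R - x - x in Affine x3 (s * (x - x3) - y).
Proof.
move=> y0; rewrite /= /slope eqxx horner_deriv_cubic.
by rewrite -addr_eq0 -mulr2n mulrn_eq0 (negPf y0).
Qed.

Lemma add_point_double E x y : on_curve E (Affine x y) -> y != 0 ->
  exists y', add_point E (Affine x y) (Affine x y) = Affine (double_x E x) y'.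
Proof.
rewrite /on_curve horner_cubic => h y0; rewrite add_point_tangent //.
eexists; congr Affine.
rewrite /double_x -h; set a := (coef_a E)%:~R in h *; set b := (coef_b E)%:~R in h *.
have hc : (coef_c E)%:~R = y ^+ 2 - (x ^+ 3 + a * x ^+ 2 + b * x) by rewrite h; ring.
rewrite hc; by field; rewrite y0.
Qed.

(** With P = (u, v) and Q = (x, y) this is Q + (P + Q) = P + (Q + Q) in generic position. The chord
    through P and Q determines the coefficients of the translated cubic, so after eliminating them
    only an identity of rational functions in free parameters remains. *)
Lemma assoc_identity (K : fieldType) (a b c x y u v : K) :
  y ^+ 2 = x ^+ 3 + a * x ^+ 2 + b * x + c ->
  v ^+ 2 = u ^+ 3 + a * u ^+ 2 + b * u + c ->
  2 * y != 0 -> u != x ->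
  let l := (y - v) / (x - u) in
  let x3 := l ^+ 2 - a - u - x in let y3 := l * (u - x3) - v in
  x3 != x ->
  let l2 := (y3 - y) / (x3 - x) in
  let x4 := l2 ^+ 2 - a - x - x3 in let y4 := l2 * (x - x4) - y in
  let m := (3 * x ^+ 2 + 2 * a * x + b) / (2 * y) in
  let x5 := m ^+ 2 - a - x - x in let y5 := m * (x - x5) - y in
  x5 != u ->
  let n := (y5 - v) / (x5 - u) in
  let x6 := n ^+ 2 - a - u - x5 in let y6 := n * (u - x6) - v in
  x4 = x6 /\ y4 = y6.
Proof.
move=> hQ hP y0 ux l x3 y3 x3x l2 x4 y4 m x5 y5 x5u n x6 y6.
have y00 : y != 0 by apply: contra y0 => /eqP ->; rewrite mulr0.
have two : 2 != 0 :> K by apply: contra y0 => /eqP ->; rewrite mul0r.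
have xu0 : x - u != 0 by rewrite subr_eq0 eq_sym.
pose w := u - x; have w0 : w != 0 by rewrite subr_eq0.
have uE : u = x + w by rewrite /w; ring.
have vE : v = y + l * w.
  by rewrite /l /w -[x - u]opprK opprB invrN mulrN mulNr divfK ?subr_eq0 //; ring.
(* translate [x] to the origin *)
pose A := a + 3 * x.
have aE : a = A - 3 * x by rewrite /A; ring.
pose z := l ^+ 2 - A - w.
have x3E : x3 = x + z by rewrite /x3 aE uE /z; ring.
have z0 : z != 0 by apply: contra x3x => /eqP z0; rewrite x3E z0 addr0.
have AE : A = l ^+ 2 - w - z by rewrite /z; ring.
have BE : 3 * x ^+ 2 + 2 * a * x + b = w * z + 2 * l * y.
  apply: (mulIf w0).
  have -> : (w * z + 2 * l * y) * w = v ^+ 2 - y ^+ 2 - w ^+ 3 - A * w ^+ 2 +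
     (w * z * w - l ^+ 2 * w ^+ 2 + w ^+ 3 + A * w ^+ 2).
    by rewrite vE; ring.
  by rewrite hP hQ uE /z aE; ring.
have y3E : y3 = - l * z - y by rewrite /y3 x3E vE uE; ring.
have mE : m = l + w * z / (2 * y) by rewrite /m BE; field; rewrite y00.
(* The tangent slope [m] exceeds the chord slope [l] by [w * q]; in terms of [q] the slopes [l2] and
   [n] become - l - 1/q and - l - w q - 1/q. *)
pose q := z / (2 * y); have q0 : q != 0 by rewrite mulf_neq0 // invr_neq0.
have zE : z = 2 * y * q by rewrite /q mulrC divfK.
have {}mE : m = l + w * q by rewrite mE /q mulrA.
have l2E : l2 = - l - q^-1.
  have e : x3 - x = 2 * y * q by rewrite x3E zE; ring.
  by rewrite /l2 e y3E zE; field; rewrite ?two ?y00 ?q0.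
have x4E : x4 = x + w + 2 * l / q + (q^-1) ^+ 2.
  by rewrite /x4 l2E x3E aE AE; field.
have x5E : x5 = x + w + q * (2 * y + 2 * l * w + w ^+ 2 * q).
  by rewrite /x5 mE aE AE zE; ring.
pose t := 2 * y + 2 * l * w + w ^+ 2 * q.
have t0 : t != 0.
  by apply: contra x5u => /eqP t0; rewrite x5E -/t t0 mulr0 addr0 uE.
have y5E : y5 - v = - (l + w * q) * (q * t) - t.
  by rewrite /y5 mE x5E -/t vE /t; ring.
have nE : n = - (l + w * q) - q^-1.
  rewrite /n y5E x5E -/t uE.
  have -> : x + w + q * t - (x + w) = q * t by ring.
  by field; rewrite q0 t0.
have x46 : x4 = x6.
  by rewrite x4E /x6 nE x5E aE AE zE uE; field.
split=> //; rewrite /y4 /y6 -x46 x4E l2E nE uE vE; by field.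
Qed.

Lemma add_point_assoc_double E Q P : on_curve E Q -> on_curve E P ->
  Q <> Infinity -> P <> Infinity -> y_coord Q != 0 ->
  x_coord P != x_coord Q -> x_coord (add_point E P Q) != x_coord Q ->
  x_coord (add_point E Q Q) != x_coord P ->
  add_point E Q (add_point E P Q) = add_point E P (add_point E Q Q).
Proof.
case: Q => [|x y] //; case: P => [|u v] //.
rewrite /on_curve !horner_cubic => hQ hP _ _; cbn [x_coord y_coord] => y0 ux.
have y20 : 2 * y != 0 by rewrite mulf_neq0.
have assoc := assoc_identity hQ hP y20 ux.
rewrite (add_point_chord E v y ux) (add_point_tangent E x y0); cbv zeta; cbn [x_coord].
move=> x3x x5u; have [e1 e2] := assoc x3x x5u.
rewrite eq_sym in x3x; rewrite eq_sym in x5u.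
by rewrite (add_point_chord E _ _ x3x) (add_point_chord E _ _ x5u); congr Affine.
Qed.

Lemma same_x_coord E P Q : P <> Infinity -> Q <> Infinity ->
  on_curve E P -> on_curve E Q -> x_coord P = x_coord Q -> P = Q \/ P = opp_point Q.
Proof.
case: P => [|u v] //; case: Q => [|x y] //= _ _ hP hQ e; subst x.
move/eqP: hP; rewrite -hQ -subr_eq0 subr_sqr mulf_eq0 subr_eq0 addr_eq0.
by move=> /orP[/eqP ->|/eqP ->]; [left|right].
Qed.

Lemma add_point_same_x E P Q : P <> Infinity -> Q <> Infinity ->
  add_point E P Q <> Infinity -> x_coord (add_point E P Q) = x_coord P ->
  add_point E P Q = opp_point P.
Proof.
case: P => [|u v] //; case: Q => [|x y] //= _ _.
by case: ifP => //= _ _ ->; rewrite subrr mulr0 add0r.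
Qed.

(** * Multiples of a point of infinite order *)

Section Multiples.
Variables (E : cubic) (P : ec_point).
Hypotheses (hP : on_curve E P) (inf : infinite_order E P).
Notation p := (fun n => mul_point E n P).

Let oc n : on_curve E (p n). Proof. exact: on_curve_mul. Qed.
Let aff n : (0 < n)%N -> p n <> Infinity. Proof. exact: inf. Qed.
Let p1 : p 1 = P. Proof. exact: add_point0. Qed.
Let pS n : p n.+1 = add_point E P (p n). Proof. by []. Qed.
Let affP : P <> Infinity. Proof. by rewrite -p1; apply: aff. Qed.
Let ocN : on_curve E (opp_point P). Proof. exact: on_curve_opp. Qed.
Let affN : opp_point P <> Infinity. Proof. by case: P affP. Qed.
Let xN Q : x_coord (opp_point Q) = x_coord Q. Proof. by case: Q. Qed.

Let mul_neq_opp n : p n <> opp_point P.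
Proof. by move=> e; apply: (@aff n.+1) => //; rewrite pS e add_point_opp. Qed.

Let x_mul_neq n : (1 < n)%N -> x_coord (p n) != x_coord P.
Proof.
case: n => [|[|n]] // _; apply/eqP => e; apply: (@mul_neq_opp n.+2).
have := @add_point_same_x E P (p n.+1) affP; rewrite -pS; apply=> //; exact: aff.
Qed.

Let mul_cancel n : (0 < n)%N -> add_point E (p n.+1) (opp_point P) = p n.
Proof.
move=> n0; have := @add_pointK E P (p n) affP; rewrite -pS; apply=> //; try exact: aff.
exact: x_mul_neq.
Qed.

Let mul_inj a b : (0 < a)%N -> (a < b)%N -> p a <> p b.
Proof.
elim: a b => [|[|a] IH] // [|[|b]] // _ ab e.
  by have := @x_mul_neq b.+2 isT; rewrite -e p1 eqxx.
by apply: (IH b.+1) => //; rewrite -mul_cancel // e mul_cancel.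
Qed.

(** Subtracting [P] from both sides lowers [a] and raises [b], until [a = 1] contradicts
    [mul_neq_opp]. *)
Let mul_neq_mul_opp a b : (0 < a)%N -> (0 < b)%N -> p a <> opp_point (p b).
Proof.
elim: a b => [|[|a] IH] // b _ b0 e.
  apply: (@mul_neq_opp b); apply: opp_point_inj; rewrite opp_pointK -e; exact: p1.
apply: (IH b.+1) => //.
by rewrite -mul_cancel // e add_opp_opp pS (add_pointC hP).
Qed.

Let x_mul_inj a b : (0 < a)%N -> (0 < b)%N -> a != b ->
  x_coord (p a) != x_coord (p b).
Proof.
move=> a0 b0 ab; apply/eqP => e.
have [h|h] := same_x_coord (aff a0) (aff b0) (oc a) (oc b) e.
  by case: (ltngtP a b) ab h => // ab _ h; [apply: mul_inj h | apply: mul_inj (esym h)].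
exact: mul_neq_mul_opp h.
Qed.

Let y_mul_neq0 a : (0 < a)%N -> y_coord (p a) != 0.
Proof.
move=> a0; apply/eqP => y0; apply: (@mul_neq_mul_opp a a) => //.
by move: y0; case: (p a) => //= x y ->; rewrite oppr0.
Qed.

Let double_aff n : (0 < n)%N -> add_point E (p n) (p n) <> Infinity.
Proof.
move=> n0; have := y_mul_neq0 n0; have := aff n0; have := oc n.
case: (p n) => // x y h _ y0.
by have [y' ->] := add_point_double h y0.
Qed.

(** Let R = (n + 1) P. If 2 R = P or 2 R = - P, subtracting R gives R = - n P or R = - (n + 2) P,
    both excluded. *)
Let x_double_neq n : (0 < n)%N -> x_coord (add_point E (p n.+1) (p n.+1)) != x_coord P.
Proof.
move=> n0; set R := p n.+1; apply/eqP => e.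
have aR : R <> Infinity by exact: aff.
have oR : on_curve E R by exact: oc.
have aV : add_point E R R <> Infinity by exact: double_aff.
have oV : on_curve E (add_point E R R) by exact: on_curve_add.
have K : add_point E (add_point E R R) (opp_point R) = R.
  by apply: add_pointK => //; rewrite e eq_sym x_mul_neq.
have [V|V] := same_x_coord aV affP oV hP e.
  apply: (@mul_neq_mul_opp n.+1 n) => //.
  rewrite -/R -K V -(mul_cancel n0) -/R -add_opp_opp opp_pointK.
  by apply: add_pointC => //; exact: on_curve_opp.
apply: (@mul_neq_mul_opp n.+1 n.+2) => //.
by rewrite -/R -K V add_opp_opp.
Qed.

(** The induction also carries n P + (n + 1) P = (2 n + 1) P. For R = (n + 1) P, generic
    associativity with - P gives - P + 2 R = R + n P, and adding P back yields 2 R; with P it gives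
    R + (P + R) = P + 2 R. *)
Lemma mul_point_double n : (0 < n)%N ->
  mul_point E (2 * n) P = add_point E (mul_point E n P) (mul_point E n P).
Proof.
suff : (0 < n)%N -> add_point E (p n) (p n) = p (2 * n)%N /\
    add_point E (p n) (p n.+1) = p (2 * n).+1.
  by move=> h /h [<-].
elim: n => [|[|n] IH] // _.
  by rewrite muln1 /= add_point0.
have [//|S T] := IH; set m := n.+1 in S T *; set R := p m.+1.
have m0 : (0 < m)%N by [].
have aR : R <> Infinity by exact: aff.
have oR : on_curve E R by exact: oc.
have NR : add_point E (opp_point P) R = p m.
  by rewrite (add_pointC ocN) // mul_cancel.
have V : add_point E R R = p (2 * m.+1)%N.
  have h1 : add_point E (opp_point P) (add_point E R R) = p (2 * m).+1.
    rewrite -add_point_assoc_double //; rewrite ?xN ?NR.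
    - by rewrite (add_pointC oR) // T.
    - exact: y_mul_neq0.
    - by rewrite eq_sym x_mul_neq.
    - by rewrite x_mul_inj // neq_ltn ltnSn.
    - exact: x_double_neq.
  have := @add_pointK E (opp_point P) (add_point E R R) affN.
  rewrite h1 opp_pointK xN => <- //.
  - by rewrite (add_pointC _ hP) // mulnS.
  - exact: double_aff.
  - exact: on_curve_add.
  - exact: aff.
  - by apply: x_mul_neq.
split=> //; rewrite pS -/R add_point_assoc_double //.
- by rewrite V.
- exact: y_mul_neq0.
- by rewrite eq_sym x_mul_neq.
- by rewrite -[add_point E P R]/(p m.+2) x_mul_inj // neq_ltn ltnSn orbT.
- exact: x_double_neq.
Qed.

Lemma double_orbit k : exists x y,
  [/\ mul_point E (2 ^ k) P = Affine x y, y != 0, on_curve E (Affine x y) &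
      exists y', mul_point E (2 ^ k.+1) P = Affine (double_x E x) y'].
Proof.
have k0 : (0 < 2 ^ k)%N by rewrite expn_gt0.
have := y_mul_neq0 k0; have := aff k0; have := oc (2 ^ k).
have := mul_point_double k0; rewrite -expnS.
case: (mul_point E (2 ^ k) P) => // x y hd h _ /= y0; exists x, y; split=> //.
by rewrite hd; exact: add_point_double.
Qed.

End Multiples.

(** * Iterated duplication *)

Section Forms.
Variables (K : comNzRingType) (a b c : K).

Definition cubic_form (n d : K) : K :=
  n ^+ 3 + a * n ^+ 2 * d + b * n * d ^+ 2 + c * d ^+ 3.

Definition double_num (n d : K) : K :=
  n ^+ 4 - 2 * b * n ^+ 2 * d ^+ 2 - 8 * c * n * d ^+ 3
  + (b ^+ 2 - 4 * a * c) * d ^+ 4.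

Definition double_den (n d : K) : K := 4 * d * cubic_form n d.

(* The dehomogenized form is [A' f - A f'], for [A] and [f] the
   dehomogenizations of [double_num] and [cubic_form]; it vanishes at the
   abscissas of the points of exact order 4. *)
Definition order4_form (n d : K) : K :=
  n ^+ 6 + 2 * a * n ^+ 5 * d + 5 * b * n ^+ 4 * d ^+ 2 + 20 * c * n ^+ 3 * d ^+ 3
  + (20 * a * c - 5 * b ^+ 2) * n ^+ 2 * d ^+ 4
  + (8 * a ^+ 2 * c - 2 * a * b ^+ 2 - 4 * b * c) * n * d ^+ 5
  + (4 * a * b * c - b ^+ 3 - 8 * c ^+ 2) * d ^+ 6.

Definition order4_form_n (n d : K) : K :=
  6 * n ^+ 5 + 10 * a * n ^+ 4 * d + 20 * b * n ^+ 3 * d ^+ 2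
  + 60 * c * n ^+ 2 * d ^+ 3 + 2 * (20 * a * c - 5 * b ^+ 2) * n * d ^+ 4
  + (8 * a ^+ 2 * c - 2 * a * b ^+ 2 - 4 * b * c) * d ^+ 5.

Definition order4_form_d (n d : K) : K :=
  2 * a * n ^+ 5 + 10 * b * n ^+ 4 * d + 60 * c * n ^+ 3 * d ^+ 2
  + 4 * (20 * a * c - 5 * b ^+ 2) * n ^+ 2 * d ^+ 3
  + 5 * (8 * a ^+ 2 * c - 2 * a * b ^+ 2 - 4 * b * c) * n * d ^+ 4
  + 6 * (4 * a * b * c - b ^+ 3 - 8 * c ^+ 2) * d ^+ 5.

(** Homogeneous form of f(x(2Q)) = y(2Q)^2, where up to sign y(2Q) is the value of [order4_form]
    divided by 8 y^3. *)
Lemma cubic_form_double n d :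
  cubic_form (double_num n d) (double_den n d) = order4_form n d ^+ 2.
Proof. by rewrite /cubic_form /double_den /double_num /order4_form /cubic_form; ring. Qed.

Lemma order4_form_euler n d :
  order4_form_n n d * n + order4_form_d n d * d = 6 * order4_form n d.
Proof. by rewrite /order4_form_n /order4_form_d /order4_form; ring. Qed.

End Forms.

Section NonsingularForms.
Variables (K : numFieldType) (a b c : K).
Hypothesis ns : forall z, z ^+ 3 + a * z ^+ 2 + b * z + c = 0 ->
  3 * z ^+ 2 + 2 * a * z + b != 0.
Let f (z : K) := z ^+ 3 + a * z ^+ 2 + b * z + c.
Let f' (z : K) := 3 * z ^+ 2 + 2 * a * z + b.

Lemma double_coprime n d : double_num a b c n d = 0 -> double_den a b c n d = 0 ->
  n = 0 /\ d = 0.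
Proof.
have [->|d0] := eqVneq d 0.
  rewrite /double_num !expr0n !mulr0 !addr0 !subr0 => /eqP.
  by rewrite expf_eq0 /= => /eqP.
have -> : n = (n / d) * d by rewrite divfK.
set z := n / d => hA hD.
have fz : f z = 0.
  move/eqP: hD; have -> : double_den a b c (z * d) d = 4 * d ^+ 4 * f z.
    by rewrite /double_den /cubic_form /f; ring.
  by rewrite !mulf_eq0 (negPf d0) pnatr_eq0 /= => /eqP.
have f'z : f' z != 0 := ns fz; move/eqP: hA.
have -> : double_num a b c (z * d) d =
    d ^+ 4 * (f' z ^+ 2 - (8 * z + 4 * a) * f z).
  by rewrite /double_num /f /f'; ring.
by rewrite fz mulr0 subr0 mulf_eq0 !expf_eq0 (negPf d0) (negPf f'z).
Qed.

Lemma order4_form_coprime n d : d * cubic_form a b c n d = 0 ->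
  order4_form a b c n d = 0 -> n = 0 /\ d = 0.
Proof.
have [->|d0] := eqVneq d 0.
  rewrite /order4_form !expr0n !mulr0 !addr0 => _ /eqP.
  by rewrite expf_eq0 /= => /eqP.
have -> : n = (n / d) * d by rewrite divfK.
set z := n / d => /eqP hF hB.
have fz : f z = 0.
  move: hF; have -> : d * cubic_form a b c (z * d) d = d ^+ 4 * f z.
    by rewrite /cubic_form /f; ring.
  by rewrite mulf_eq0 expf_eq0 (negPf d0) => /eqP.
have f'z : f' z != 0 := ns fz; move/eqP: hB.
have -> : order4_form a b c (z * d) d = d ^+ 6 *
    ((4 * z ^+ 3 - 4 * b * z - 8 * c) * f z
     - (f' z ^+ 2 - (8 * z + 4 * a) * f z) * f' z).
  by rewrite /order4_form /f /f'; ring.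
rewrite fz !mulr0 subr0 sub0r mulf_eq0 expf_eq0 (negPf d0) /= oppr_eq0.
by rewrite mulf_eq0 expf_eq0 (negPf f'z).
Qed.

(** A root z is the abscissa of a point whose double is a point (e, 0) of order 2. The duplication
    formula becomes a perfect square, giving t^2 = f'(e) for t = z - e. In terms of t and e, the
    derivative at z is 8 t^4 (2 t + 3 e + a) and f(z) = t^2 (2 t + 3 e + a), which is nonzero. *)
Lemma order4_form_smooth n d : order4_form a b c n d = 0 ->
  order4_form_n a b c n d = 0 -> order4_form_d a b c n d = 0 -> n = 0 /\ d = 0.
Proof.
have [->|d0] := eqVneq d 0.
  rewrite /order4_form !expr0n !mulr0 !addr0 => /eqP + _ _.
  by rewrite expf_eq0 /= => /eqP.
move=> hB hBn _; exfalso.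
have hnz : d * cubic_form a b c n d != 0.
  by apply: contra d0 => /eqP h; have [_ ->] := order4_form_coprime h hB.
have nE : n = (n / d) * d by rewrite divfK.
move: nE hB hBn hnz; set z := n / d => -> hB hBn.
have -> : d * cubic_form a b c (z * d) d = d ^+ 4 * f z.
  by rewrite /cubic_form /f; ring.
rewrite mulf_eq0 negb_or => /andP[_ fz].
pose e := double_num a b c z 1 / (4 * f z).
have f4 : 4 * f z != 0 by rewrite mulf_neq0 // pnatr_eq0.
have hA : double_num a b c z 1 = e * (4 * f z) by rewrite divfK.
have fe : f e = 0.
  have : (4 * f z) ^+ 3 * f e * d ^+ 12 = 0.
    rewrite (_ : _ * _ = order4_form a b c (z * d) d ^+ 2); first by rewrite hB expr0n.
    have -> : order4_form a b c (z * d) d = order4_form a b c z 1 * d ^+ 6.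
      by rewrite /order4_form; ring.
    rewrite [RHS]exprMn -cubic_form_double hA /double_den /cubic_form /f; ring.
  by move/eqP; rewrite mulf_eq0 (expf_eq0 d) (negPf d0) orbF mulf_eq0 expf_eq0 (negPf f4) => /eqP.
pose t := z - e; have zE : z = e + t by rewrite /t; ring.
have ht : t ^+ 2 = f' e.
  have : (t ^+ 2 - f' e) ^+ 2 == 0.
    have -> : (t ^+ 2 - f' e) ^+ 2 = double_num a b c z 1 - e * (4 * f z)
        + (8 * z + 4 * e + 4 * a) * f e.
      by rewrite zE /double_num /f /f'; ring.
    by rewrite hA fe mulr0 subrr addr0.
  by rewrite expf_eq0 /= subr_eq0 => /eqP.
have bE : b = t ^+ 2 - 3 * e ^+ 2 - 2 * a * e by rewrite ht /f'; ring.
have cE : c = - (e ^+ 3 + a * e ^+ 2 + b * e).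
  by apply/eqP; rewrite -subr_eq0 opprK addrC -/(f e) fe.
have fzE : f z = t ^+ 2 * (2 * t + (3 * e + a)).
  by rewrite /f cE bE zE; ring.
have : 8 * t ^+ 4 * (2 * t + (3 * e + a)) * d ^+ 5 = order4_form_n a b c (z * d) d.
  by rewrite /order4_form_n cE bE zE; ring.
rewrite hBn => /eqP; rewrite mulf_eq0 (expf_eq0 d) (negPf d0) orbF mulf_eq0.
move: fz; rewrite fzE mulf_eq0 expf_eq0 /= negb_or => /andP[t0 /negPf ->].
by rewrite orbF mulf_eq0 pnatr_eq0 expf_eq0 (negPf t0).
Qed.

End NonsingularForms.

Section FormMorphism.
Variables (K L : comNzRingType) (h : {rmorphism K -> L}) (a b c n d : K).

Lemma rmorph_cubic_form :
  h (cubic_form a b c n d) = cubic_form (h a) (h b) (h c) (h n) (h d).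
Proof. by rewrite /cubic_form !(rmorphXn, rmorphD, rmorphM). Qed.

Lemma rmorph_double_num :
  h (double_num a b c n d) = double_num (h a) (h b) (h c) (h n) (h d).
Proof.
by rewrite /double_num !(rmorph_nat, rmorphXn, rmorphB, rmorphD, rmorphM).
Qed.

Lemma rmorph_double_den :
  h (double_den a b c n d) = double_den (h a) (h b) (h c) (h n) (h d).
Proof. by rewrite /double_den !rmorphM rmorph_nat rmorph_cubic_form. Qed.

Lemma rmorph_order4_form :
  h (order4_form a b c n d) = order4_form (h a) (h b) (h c) (h n) (h d).
Proof.
by rewrite /order4_form !(rmorph_nat, rmorphXn, rmorphB, rmorphD, rmorphM).
Qed.

Lemma rmorph_order4_form_n :
  h (order4_form_n a b c n d) = order4_form_n (h a) (h b) (h c) (h n) (h d).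
Proof.
by rewrite /order4_form_n !(rmorph_nat, rmorphXn, rmorphB, rmorphD, rmorphM).
Qed.

Lemma rmorph_order4_form_d :
  h (order4_form_d a b c n d) = order4_form_d (h a) (h b) (h c) (h n) (h d).
Proof.
by rewrite /order4_form_d !(rmorph_nat, rmorphXn, rmorphB, rmorphD, rmorphM).
Qed.
End FormMorphism.

Section Derivatives.
Variables (a b c : int) (n d : {poly int}).

Let deriv_nat m : deriv (m%:R : {poly int}) = 0.
Proof. by rewrite -polyC_natr derivC. Qed.
Let derivXn2 (p : {poly int}) k : deriv (p ^+ k.+1) = k.+1%:R * p ^+ k * deriv p.
Proof. by rewrite deriv_exp /= -mulr_natl; ring. Qed.

Lemma deriv_order4_form :
  deriv (order4_form a%:P b%:P c%:P n d) =
  order4_form_n a%:P b%:P c%:P n d * deriv n + order4_form_d a%:P b%:P c%:P n d * deriv d.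
Proof.
rewrite /order4_form /order4_form_n /order4_form_d.
rewrite !(deriv_nat, derivC, derivXn2, derivB, derivD, derivN, derivM) /=; ring.
Qed.

(** Duplication multiplies the invariant differential dx / y by 2, so the derivative of x(2Q) with
    respect to x is 2 y(2Q) / y; its numerator is [order4_form] up to a constant. *)
Lemma wronskian_double :
  deriv (double_num a%:P b%:P c%:P n d) * double_den a%:P b%:P c%:P n d
  - double_num a%:P b%:P c%:P n d * deriv (double_den a%:P b%:P c%:P n d) =
  4 * order4_form a%:P b%:P c%:P n d * (deriv n * d - n * deriv d).
Proof.
rewrite /double_num /double_den /cubic_form /order4_form.
rewrite !(deriv_nat, derivC, derivXn2, derivB, derivD, derivN, derivM) /=; ring.
Qed.
End Derivatives.

(** * Polynomials of iterated duplication and their simple roots *)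

Fixpoint double_iter (E : cubic) i : {poly int} * {poly int} :=
  let a := (coef_a E)%:P in let b := (coef_b E)%:P in let c := (coef_c E)%:P in
  if i is j.+1 then let: (n, d) := double_iter E j in
    (double_num a b c n d, double_den a b c n d)
  else ('X, 1).

Definition order4_iter (E : cubic) i : {poly int} :=
  order4_form (coef_a E)%:P (coef_b E)%:P (coef_c E)%:P
    (double_iter E i).1 (double_iter E i).2.

Definition eval_int (K : comNzRingType) (x : K) (p : {poly int}) : K :=
  (map_poly intr p).[x].

HB.instance Definition _ (K : comNzRingType) (x : K) :=
  GRing.RMorphism.copy (eval_int x) (horner_eval x \o map_poly intr).

Arguments eval_int : simpl never.

Lemma eval_intC (K : comNzRingType) (x : K) z : eval_int x z%:P = z%:~R.
Proof. by rewrite /eval_int map_polyC hornerC. Qed.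

Lemma double_iterS E i :
  double_iter E i.+1 =
  (double_num (coef_a E)%:P (coef_b E)%:P (coef_c E)%:P (double_iter E i).1 (double_iter E i).2,
   double_den (coef_a E)%:P (coef_b E)%:P (coef_c E)%:P (double_iter E i).1 (double_iter E i).2).
Proof. by rewrite /=; case: (double_iter E i). Qed.

Section Separable.
Variable E : cubic.
Hypothesis ns : nonsingular E.
Let a : algC := (coef_a E)%:~R.
Let b : algC := (coef_b E)%:~R.
Let c : algC := (coef_c E)%:~R.

Lemma cubic_ns z : z ^+ 3 + a * z ^+ 2 + b * z + c = 0 ->
  3 * z ^+ 2 + 2 * a * z + b != 0.
Proof.
move=> h; apply/eqP => h'; apply: (@ns z 0).
by rewrite /singular_point horner_cubic horner_deriv_cubic -/a -/b -/c h h'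
  expr0n mulr0 oppr0.
Qed.

Variable x : algC.
Let n i := eval_int x (double_iter E i).1.
Let d i := eval_int x (double_iter E i).2.

Let nS i : n i.+1 = double_num a b c (n i) (d i).
Proof. by rewrite /n double_iterS /= rmorph_double_num /= !eval_intC. Qed.
Let dS i : d i.+1 = double_den a b c (n i) (d i).
Proof. by rewrite /d double_iterS /= rmorph_double_den /= !eval_intC. Qed.

Let nd0 i : ~ (n i = 0 /\ d i = 0).
Proof.
elim: i => [|i IH].
  by rewrite /d /= rmorph1 => -[_ /eqP]; rewrite oner_eq0.
by rewrite nS dS => -[h1 h2]; apply: IH; apply: (double_coprime cubic_ns).
Qed.

(** After a zero at stage i, [d * cubic_form] vanishes at every later stage: at i + 1 by
    [cubic_form_double], then because [double_den] contains this product. *)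
Let order4_disjoint i j : order4_form a b c (n i) (d i) = 0 -> (i < j)%N ->
  order4_form a b c (n j) (d j) != 0.
Proof.
move=> hi ij; apply/eqP => hj; apply: (@nd0 j).
apply: (order4_form_coprime cubic_ns) => //.
elim: j ij {hj} => // j IH; rewrite ltnS leq_eqVlt => /orP[/eqP <-|/IH h].
  by rewrite nS dS cubic_form_double hi expr0n mulr0.
by rewrite [d j.+1]dS /double_den -mulrA h mulr0 mul0r.
Qed.

(** If the derivative vanished too, the chain rule and Euler's identity would be a homogeneous
    linear system in the two partial derivatives of [order4_form]. Its determinant n' d - n d' is up
    to a constant the product of the earlier [order4_form] values, nonzero by [order4_disjoint], so
    both partials would vanish. *)
Lemma deriv_order4_iter_neq0 i : eval_int x (order4_iter E i) = 0 ->
  eval_int x (deriv (order4_iter E i)) != 0.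
Proof.
rewrite /order4_iter rmorph_order4_form /= !eval_intC -/(n i) -/(d i) -/a -/b -/c => hi.
pose n' j := eval_int x (deriv (double_iter E j).1).
pose d' j := eval_int x (deriv (double_iter E j).2).
have w0 : n' i * d i - n i * d' i != 0.
  (* The stage is generalised to some j at most [i], while the vanishing at [i] stays available for
     [order4_disjoint]. *)
  have : (i <= i)%N by [].
  elim: {1 3 4 5 6}i => [|j IH] ji.
    by rewrite /n' /d' /d /= derivX derivC rmorph1 rmorph0 mulr0 subr0 mul1r oner_eq0.
  have -> : n' j.+1 * d j.+1 - n j.+1 * d' j.+1 =
      4 * order4_form a b c (n j) (d j) * (n' j * d j - n j * d' j).
    rewrite /n' /d' /n /d double_iterS /= -!rmorphM -!rmorphB wronskian_double.
    by rewrite !(rmorphM, rmorphB) rmorph_nat rmorph_order4_form /= !eval_intC.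
  rewrite mulf_neq0 ?IH 1?ltnW // mulf_neq0 ?pnatr_eq0 //.
  by apply/eqP => /order4_disjoint/(_ ji); rewrite hi eqxx.
apply/eqP => hd.
have {}hd : order4_form_n a b c (n i) (d i) * n' i
          + order4_form_d a b c (n i) (d i) * d' i = 0.
  rewrite -hd deriv_order4_form rmorphD !rmorphM rmorph_order4_form_n.
  by rewrite rmorph_order4_form_d /= !eval_intC.
have he := order4_form_euler a b c (n i) (d i); rewrite hi mulr0 in he.
set Bn := order4_form_n _ _ _ _ _ in hd he; set Bd := order4_form_d _ _ _ _ _ in hd he.
have h1 : Bn * (n' i * d i - n i * d' i) = 0.
  transitivity ((Bn * n' i + Bd * d' i) * d i - (Bn * n i + Bd * d i) * d' i); first ring.
  by rewrite hd he !mul0r subrr.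
have h2 : Bd * (n' i * d i - n i * d' i) = 0.
  transitivity ((Bn * n i + Bd * d i) * n' i - (Bn * n' i + Bd * d' i) * n i); first ring.
  by rewrite hd he !mul0r subrr.
apply: (@nd0 i); apply: (order4_form_smooth cubic_ns) => //.
  by apply/eqP; move/eqP: h1; rewrite mulf_eq0 (negPf w0) orbF.
by apply/eqP; move/eqP: h2; rewrite mulf_eq0 (negPf w0) orbF.
Qed.

End Separable.

Lemma separable_order4_iter E i : nonsingular E ->
  separable_poly (map_poly intr (order4_iter E i) : {poly rat}).
Proof.
move=> ns; rewrite -(separable_map (ratr : {rmorphism rat -> algC})) -map_poly_comp.
rewrite (eq_map_poly (g := intr)); last by move=> z /=; rewrite ratr_int.
rewrite separable_poly.unlock; apply/Pdiv.ClosedField.coprimepP => x /rootP h.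
by rewrite deriv_map; apply: deriv_order4_iter_neq0.
Qed.

(** * Degrees of the iterates *)

Definition deg_leq (p : {poly int}) k := (size p <= k.+1)%N.
Definition monic_deg (p : {poly int}) k := p \is monic /\ size p = k.+1.

Lemma deg_leqW p j k : deg_leq p j -> (j <= k)%N -> deg_leq p k.
Proof. by rewrite /deg_leq => /leq_trans h jk; apply: h. Qed.

Lemma deg_leqN p k : deg_leq p k -> deg_leq (- p) k.
Proof. by rewrite /deg_leq size_polyN. Qed.

Lemma deg_leqD p q j k : deg_leq p j -> deg_leq q k -> deg_leq (p + q) (maxn j k).
Proof.
rewrite /deg_leq => hp hq; apply: leq_trans (size_polyD _ _) _.
by rewrite -maxnSS geq_max !leq_max hp hq orbT.
Qed.

Lemma deg_leqM p q j k : deg_leq p j -> deg_leq q k -> deg_leq (p * q) (j + k).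
Proof.
rewrite /deg_leq => hp hq; apply: leq_trans (size_polyMleq _ _) _.
by rewrite -subn1 leq_subLR add1n -addnS -addSn leq_add.
Qed.

Lemma deg_leqX p j k : deg_leq p j -> deg_leq (p ^+ k) (j * k).
Proof.
move=> hp; elim: k => [|k IH]; first by rewrite /deg_leq expr0 size_poly1.
by rewrite exprS mulnS; apply: deg_leqM.
Qed.

Lemma deg_leqC (c : int) : deg_leq c%:P 0.
Proof. exact: size_polyC_leq1. Qed.

Lemma deg_leq_nat k : deg_leq k%:R 0.
Proof. by rewrite -polyC_natr; apply: deg_leqC. Qed.

Lemma monic_deg_leq p k : monic_deg p k -> deg_leq p k.
Proof. by rewrite /deg_leq => -[_ ->]. Qed.

Lemma monic_degD p q k : monic_deg p k.+1 -> deg_leq q k -> monic_deg (p + q) k.+1.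
Proof.
move=> [hm hs] hq; have lt : (size q < size p)%N by rewrite hs.
by split; [rewrite monicE lead_coefDl ?(monicP hm) | rewrite size_polyDl].
Qed.

Lemma monic_degX p j k : monic_deg p j -> monic_deg (p ^+ k) (j * k).
Proof.
move=> [hm hs]; split; first exact: monic_exp.
have := size_exp p k; rewrite hs /=.
have : size (p ^+ k) != 0%N by rewrite size_poly_eq0 monic_neq0 // monic_exp.
by case: (size (p ^+ k)) => // m _ /= ->.
Qed.

Ltac deg_bound := lazymatch goal with
  | |- is_true (deg_leq (_ + _) _) => eapply deg_leqD; deg_bound
  | |- is_true (deg_leq (- _) _) => eapply deg_leqN; deg_bound
  | |- is_true (deg_leq (_ * _) _) => eapply deg_leqM; deg_bound
  | |- is_true (deg_leq (_ ^+ _) _) => eapply deg_leqX; deg_bound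
  | |- is_true (deg_leq _%:P _) => eapply deg_leqC
  | |- is_true (deg_leq (_ *+ _) _) => eapply deg_leq_nat
  | |- _ => eassumption
  end.

Ltac deg_solve := eapply deg_leqW; [deg_bound | lia].

Lemma double_iter_deg E i : exists2 m, (4 ^ i = m.+1)%N &
  monic_deg (double_iter E i).1 m.+1 /\ deg_leq (double_iter E i).2 m.
Proof.
elim: i => [|i [m mE [hn hd]]].
  exists 0%N => //=; split; last by rewrite /deg_leq size_poly1.
  by split; rewrite ?monicX ?size_polyX.
exists (4 * m.+1).-1; first by rewrite expnS mE.
have hn' := monic_deg_leq hn.
rewrite double_iterS; set n := (double_iter E i).1 in hn hn' *.
set d := (double_iter E i).2 in hd *; cbn [fst snd]; split; last first.
  by rewrite /double_den /cubic_form; deg_solve.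
rewrite /double_num; do 3 (apply: monic_degD; last by deg_solve).
have -> : (4 * m.+1).-1.+1 = (m.+1 * 4)%N by lia.
exact: monic_degX.
Qed.

(** The degree is the number of abscissas of points of exact order 2^(i+2), namely half of 4^(i+2) -
    4^(i+1). *)
Lemma monic_order4_iter E i :
  order4_iter E i \is monic /\ size (order4_iter E i) = (6 * 4 ^ i).+1.
Proof.
have [m mE [hn hd]] := double_iter_deg E i; rewrite mE.
have hn' := monic_deg_leq hn; rewrite -/(monic_deg _ _) /order4_iter.
set n := (double_iter E i).1 in hn hn' *; set d := (double_iter E i).2 in hd *.
have -> : (6 * m.+1 = (6 * m.+1).-1.+1)%N by lia.
rewrite /order4_form; do 6 (apply: monic_degD; last by deg_solve).
have -> : (6 * m.+1).-1.+1 = (m.+1 * 6)%N by lia.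
exact: monic_degX.
Qed.

Section Homogeneity.
Variables (K : fieldType) (a b c n d : K).
Hypothesis d0 : d != 0.

Lemma cubic_form_homog : cubic_form a b c n d = d ^+ 3 * cubic_form a b c (n / d) 1.
Proof. by rewrite /cubic_form; field. Qed.

Lemma double_num_homog : double_num a b c n d = d ^+ 4 * double_num a b c (n / d) 1.
Proof. by rewrite /double_num; field. Qed.

Lemma double_den_homog : double_den a b c n d = d ^+ 4 * double_den a b c (n / d) 1.
Proof. by rewrite /double_den /cubic_form; field. Qed.
End Homogeneity.

(** * Height and real size along the orbit *)

Definition rat_height (x : rat) : nat := maxn `|numq x| `|denq x|.

Lemma rat_height_frac (p q : int) N : (`|p| <= N)%N -> (`|q| <= N)%N -> q != 0 ->
  (rat_height (p%:~R / q%:~R) <= N)%N.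
Proof.
rewrite /rat_height geq_max; case: divqP => [_ _ _|k x k0]; first by rewrite eqxx.
rewrite !abszM => hp hq _; have k1 : (0 < `|k|)%N by rewrite absz_gt0.
by rewrite (leq_trans _ hp) ?leq_pmull // (leq_trans _ hq) ?leq_pmull.
Qed.

Lemma leq_expr_base m n k : (m <= n)%N -> (m ^ k <= n ^ k)%N.
Proof. by case: k => // k h; rewrite leq_exp2r. Qed.

Lemma abszD_leq (x y : int) m n : (`|x| <= m)%N -> (`|y| <= n)%N ->
  (`|(x + y)%R| <= m + n)%N.
Proof. lia. Qed.

Section Orbit.
Variable E : cubic.
Notation a := ((coef_a E)%:~R : rat).
Notation b := ((coef_b E)%:~R : rat).
Notation c := ((coef_c E)%:~R : rat).
Let f x := cubic_form a b c x 1.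

Let double_xE x : double_x E x = double_num a b c x 1 / (4 * f x).
Proof. by rewrite /double_x /double_num /f /cubic_form !expr1n !mulr1. Qed.

Lemma rat_height_double : exists2 C, (0 < C)%N &
  forall x, f x != 0 -> (rat_height (double_x E x) <= C * rat_height x ^ 4)%N.
Proof.
pose A := coef_a E; pose B := coef_b E; pose G := coef_c E.
pose C1 := (1 + 2 * `|B| + 8 * `|G| + `|(B ^+ 2 - 4 * A * G)%R|)%N.
pose C2 := (4 * (1 + `|A| + `|B| + `|G|))%N.
exists (C1 + C2)%N; first by rewrite /C1 -!addnA.
move=> x fx; set p := numq x; set q := denq x; set h := rat_height x.
have q0 : q%:~R != 0 :> rat by rewrite intr_eq0 denq_neq0.
have ph : (`|p| <= h)%N by rewrite /h /rat_height leq_maxl.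
have qh : (`|q| <= h)%N by rewrite /h /rat_height leq_maxr.
have xE : x = p%:~R / q%:~R by rewrite divq_num_den.
have mon (z : int) i j m : (i + j = 4)%N -> (`|z| <= m)%N ->
    (`|(z * p ^+ i * q ^+ j)%R| <= m * h ^ 4)%N.
  move=> ij zm; rewrite !abszM !abszX -mulnA leq_mul // -ij expnD.
  by rewrite leq_mul // leq_expr_base.
have -> : double_x E x = (double_num A B G p q)%:~R / (double_den A B G p q)%:~R.
  rewrite rmorph_double_num rmorph_double_den /= -/a -/b -/c.
  rewrite double_num_homog // double_den_homog // -xE double_xE.
  by rewrite -mulf_div divff ?expf_neq0 // mul1r /double_den mulr1.
have den0 : double_den A B G p q != 0.
  rewrite -(intr_eq0 rat) rmorph_double_den /= double_den_homog // -xE.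
  by rewrite /double_den mulr1 !mulf_neq0 ?expf_neq0.
apply: rat_height_frac => //.
  apply: (@leq_trans (C1 * h ^ 4)); last by rewrite leq_mul2r leq_addr orbT.
  have -> : double_num A B G p q = 1 * p ^+ 4 * q ^+ 0 + (- 2 * B) * p ^+ 2 * q ^+ 2
     + (- 8 * G) * p ^+ 1 * q ^+ 3 + (B ^+ 2 - 4 * A * G) * p ^+ 0 * q ^+ 4.
    by rewrite /double_num; ring.
  rewrite /C1 3!mulnDl; do 3 (apply: abszD_leq; last by apply: mon; rewrite ?abszM).
  by apply: mon; rewrite ?abszM.
apply: (@leq_trans (C2 * h ^ 4)); last by rewrite leq_mul2r leq_addl orbT.
have -> : double_den A B G p q = 4 * p ^+ 3 * q ^+ 1 + (4 * A) * p ^+ 2 * q ^+ 2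
   + (4 * B) * p ^+ 1 * q ^+ 3 + (4 * G) * p ^+ 0 * q ^+ 4.
  by rewrite /double_den /cubic_form; ring.
rewrite /C2 3!mulnDr 3!mulnDl; do 3 (apply: abszD_leq; last by apply: mon; rewrite ?abszM).
  by apply: mon; rewrite ?abszM.
Qed.

(** The duplicated abscissa behaves like x / 4. For large x its numerator and the cubic lie within
    factors 1/2 and 3/2 of their leading terms, so the quotient is between |x| / 12 and 3 |x| /
    4. *)
Lemma double_x_growth : exists2 M : nat, (0 < M)%N & forall x : rat, (M%:R : rat) < `|x| ->
  `|double_x E x| <= `|x| /\ `|x| <= 12 * `|double_x E x|.
Proof.
pose L := 2 * `|b| + 8 * `|c| + `|b ^+ 2 - 4 * a * c| + `|a| + 1.
have L0 : 0 <= L by rewrite /L !addr_ge0 // mulr_ge0.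
exists (Num.truncn (2 * L)).+1 => // x hx.
have xL : 2 * L <= `|x|.
  have /truncn_itv/andP[_ h] : 0 <= 2 * L by rewrite mulr_ge0.
  by rewrite ltW // (lt_trans h).
have x1 : 1 <= `|x|.
  have : 1 <= L by rewrite /L lerDr !addr_ge0 // mulr_ge0.
  by move: xL; lra.
set y := `|x| in x1 xL *; have y0 : 0 < y by apply: lt_le_trans x1.
have hA : `|double_num a b c x 1 - x ^+ 4| <= y ^+ 4 / 2.
  have -> : double_num a b c x 1 - x ^+ 4 =
     - (2 * b) * x ^+ 2 + (- (8 * c) * x + (b ^+ 2 - 4 * a * c)).
    by rewrite /double_num; ring.
  rewrite (le_trans (ler_normD _ _)) // (le_trans (lerD (lexx _) (ler_normD _ _))) //.
  have -> : `|- (2 * b) * x ^+ 2| = 2 * `|b| * y ^+ 2.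
    by rewrite normrM normrN normrM normr_nat normrX.
  have -> : `|- (8 * c) * x| = 8 * `|c| * y by rewrite normrM normrN normrM normr_nat.
  have h1 : y <= y ^+ 2 by rewrite expr2 ler_peMl // ltW.
  have h2 : 1 <= y ^+ 2 by apply: le_trans h1.
  have b0 := normr_ge0 b; have c0 := normr_ge0 c.
  have e0 := normr_ge0 (b ^+ 2 - 4 * a * c); have a0 := normr_ge0 a.
  have h3 : 2 * `|b| * y ^+ 2 + (8 * `|c| * y + `|b ^+ 2 - 4 * a * c|) <= L * y ^+ 2.
    have := ler_wpM2l c0 h1; have := ler_wpM2l e0 h2; rewrite /L !mulrDl.
    have : 0 <= `|a| * y ^+ 2 by rewrite mulr_ge0 // sqr_ge0.
    have := sqr_ge0 y; lra.
  apply: le_trans h3 _; have -> : y ^+ 4 / 2 = (y ^+ 2 / 2) * y ^+ 2 by field.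
  by rewrite ler_wpM2r ?sqr_ge0 //; move: h1 xL; lra.
have hF : `|f x - x ^+ 3| <= y ^+ 3 / 2.
  have -> : f x - x ^+ 3 = a * x ^+ 2 + (b * x + c).
    by rewrite /f /cubic_form; ring.
  rewrite (le_trans (ler_normD _ _)) // (le_trans (lerD (lexx _) (ler_normD _ _))) //.
  have -> : `|a * x ^+ 2| = `|a| * y ^+ 2 by rewrite normrM normrX.
  have -> : `|b * x| = `|b| * y by rewrite normrM.
  have h1 : y <= y ^+ 2 by rewrite expr2 ler_peMl // ltW.
  have h2 : 1 <= y ^+ 2 by apply: le_trans h1.
  have b0 := normr_ge0 b; have c0 := normr_ge0 c.
  have e0 := normr_ge0 (b ^+ 2 - 4 * a * c).
  have h3 : `|a| * y ^+ 2 + (`|b| * y + `|c|) <= L * y ^+ 2.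
    rewrite /L; move: `|a| `|b| `|c| `|_ - _| (y ^+ 2) b0 c0 e0 h1 h2.
    by move=> u v w e z v0 w0 e0 yz z1; nra.
  apply: le_trans h3 _; have -> : y ^+ 3 / 2 = (y / 2) * y ^+ 2 by field.
  by rewrite ler_wpM2r ?sqr_ge0 //; move: xL; lra.
have nA : `|x ^+ 4| = y ^+ 4 by rewrite normrX.
have nF : `|x ^+ 3| = y ^+ 3 by rewrite normrX.
have A1 : `|double_num a b c x 1| <= y ^+ 4 * (3 / 2).
  have := ler_normD (double_num a b c x 1 - x ^+ 4) (x ^+ 4).
  by rewrite subrK nA; move: hA; lra.
have A2 : y ^+ 4 / 2 <= `|double_num a b c x 1|.
  have := ler_normD (x ^+ 4 - double_num a b c x 1) (double_num a b c x 1).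
  by rewrite subrK nA distrC; move: hA; lra.
have F1 : `|f x| <= y ^+ 3 * (3 / 2).
  have := ler_normD (f x - x ^+ 3) (x ^+ 3).
  by rewrite subrK nF; move: hF; lra.
have F2 : y ^+ 3 / 2 <= `|f x|.
  have := ler_normD (x ^+ 3 - f x) (f x).
  by rewrite subrK nF distrC; move: hF; lra.
have y3 : 0 < y ^+ 3 by rewrite exprn_gt0.
have f0 : 0 < `|f x| by apply: lt_le_trans F2; rewrite divr_gt0.
rewrite double_xE normrM normfV normrM normr_nat; split.
  rewrite ler_pdivrMr ?mulr_gt0 //; have := ler_wpM2l (ltW y0) F2.
  have -> : y * (y ^+ 3 / 2) = y ^+ 4 / 2 by field.
  by have : 0 <= y ^+ 4 by [rewrite exprn_ge0 // ltW]; move: A1; lra.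
rewrite mulrA ler_pdivlMr ?mulr_gt0 //; have := ler_wpM2l (ltW y0) F1.
have -> : y * (y ^+ 3 * (3 / 2)) = y ^+ 4 * (3 / 2) by field.
by have : 0 <= y ^+ 4 by [rewrite exprn_ge0 // ltW]; move: A2; lra.
Qed.

Variable X : nat -> rat.
Hypothesis XS : forall k, X k.+1 = double_x E (X k).
Hypothesis fX : forall k, f (X k) != 0.

Lemma rat_height_orbit : exists2 B, (0 < B)%N &
  forall k, (rat_height (X k) <= B ^ (4 ^ k))%N.
Proof.
have [C C0 hC] := rat_height_double.
exists (C * rat_height (X 0%N))%N.
  by rewrite muln_gt0 C0 /rat_height leq_max !absz_gt0 denq_neq0 orbT.
(* Carrying the factor [C] closes the induction, since C (C h^4) is at most (C h)^4. *)
move=> k; suff h : (C * rat_height (X k) <= (C * rat_height (X 0%N)) ^ 4 ^ k)%N.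
  by apply: leq_trans h; rewrite leq_pmull.
elim: k => [|k IH]; first by rewrite expn0 expn1.
rewrite expnSr expnM; apply: leq_trans (leq_expr_base 4 IH).
rewrite expnMn XS (leq_trans (leq_mul (leqnn C) (hC _ (fX k)))) //.
by rewrite mulnA leq_mul2r -[(C * C)%N]/(C ^ 2)%N leq_pexp2l ?orbT.
Qed.

Lemma orbit_double_iter t i : eval_int (X t) (double_iter E i).2 != 0 /\
  X (t + i)%N = eval_int (X t) (double_iter E i).1 / eval_int (X t) (double_iter E i).2.
Proof.
elim: i => [|i [d0 IH]].
  by rewrite /= rmorph1 oner_eq0 addn0 divr1 /eval_int map_polyX hornerX.
rewrite double_iterS /= rmorph_double_num rmorph_double_den /= !eval_intC.
rewrite double_num_homog // double_den_homog // -IH; split.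
  rewrite mulf_neq0 ?expf_neq0 // /double_den mulr1 mulf_neq0 //; exact: fX.
rewrite addnS XS double_xE -mulf_div divff ?expf_neq0 // mul1r.
by rewrite /double_den mulr1.
Qed.

(** This pulls smallness back along the orbit: if the cubic is small at [X (t + i.+1)], then [X t]
    nearly is a root of [order4_iter E i]. *)
Lemma order4_iter_sqr t i : eval_int (X t) (order4_iter E i) ^+ 2 =
  eval_int (X t) (double_iter E i.+1).2 ^+ 3 * f (X (t + i.+1)%N).
Proof.
have [d0 ->] := orbit_double_iter t i.+1.
rewrite /f -cubic_form_homog // double_iterS /= /order4_iter.
rewrite rmorph_double_num rmorph_double_den rmorph_order4_form /= !eval_intC.
by rewrite cubic_form_double.
Qed.

End Orbit.

Lemma eval_int_bounded (p : {poly int}) (M : rat) : 0 <= M ->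
  exists2 C, 0 < C & forall x : rat, `|x| <= M -> `|eval_int x p| <= C.
Proof. exact: poly_bounded. Qed.

Lemma orbit_lt_exp (E : cubic) (X : nat -> rat) (theta : rat) :
  nonsingular E -> (forall k, X k.+1 = double_x E (X k)) ->
  (forall k, cubic_form (coef_a E)%:~R (coef_b E)%:~R (coef_c E)%:~R (X k) 1 != 0) ->
  1 < theta -> exists K, forall k, (K <= k)%N -> `|X k| < theta ^+ (4 ^ k).
Proof.
move=> ns XS fX t1; apply: contrapT => hN.
have t0 : 0 < theta by apply: lt_trans t1.
have ub0 : unbounded (fun k => theta ^+ (4 ^ k) <= `|X k|).
  move=> K; apply: contrapT => h; apply: hN; exists K => k Kk.
  by rewrite ltNge; apply/negP => hk; apply: h; exists k.
have [M M0 growth] := double_x_growth E.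
have M1 : 1 <= M%:R :> rat by rewrite ler1n.
(* Duplication does not increase an abscissa beyond [M], so a huge value must first arise from a
   bounded [X l], where the cubic is then tiny. *)
have ub1 : unbounded (fun l => theta ^+ (4 ^ l.+1) <= `|X l.+1| /\ `|X l| <= M%:R).
  have climb V K j : `|X K| < V -> V <= `|X (K + j)%N| ->
      exists l, [/\ (K <= l < K + j)%N, V <= `|X l.+1| & `|X l| <= M%:R].
    move=> XV; elim: j => [|j IH]; first by rewrite addn0 leNgt XV.
    rewrite addnS => hV; case: (leP `|X (K + j)%N| M%:R) => hM.
      by exists (K + j)%N; rewrite leq_addr ltnSn.
    have [h _] := growth _ hM; rewrite -XS in h.
    have [l [/andP[l1 l2] h1 h2]] := IH (le_trans hV h).
    by exists l; split=> //; rewrite l1 ltnS ltnW.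
  move=> K; have [n0 hn0] := exp_exp4_unbounded (`|X K| + 1) t1.
  have [k kK hk] := ub0 (K + n0)%N.
  have n0k : (n0 <= k)%N by apply: leq_trans kK; rewrite leq_addl.
  have Kk : (K <= k)%N by apply: leq_trans kK; rewrite leq_addr.
  have XV : `|X K| < theta ^+ (4 ^ k) by rewrite (lt_le_trans _ (hn0 _ n0k)) // ltrDl.
  rewrite -(subnKC Kk) in hk; rewrite -{1}(subnKC Kk) in XV.
  have [l [/andP[l1 l2] h1 h2]] := climb _ _ _ XV hk; exists l => //; split=> //.
  by apply: le_trans h1; rewrite ler_eXn2l // leq_pexp2l.
have back j n : `|X (n + j)%N| <= M%:R -> `|X n| <= 12 ^+ j * M%:R.
  elim: j n => [|j IH] n; first by rewrite addn0 mul1r.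
  rewrite addnS -addSn => /IH h; case: (leP `|X n| M%:R) => hM.
    by rewrite (le_trans hM) // ler_peMl // exprn_ege1.
  have [_] := growth _ hM; rewrite -XS => /le_trans; apply.
  by rewrite exprS -mulrA ler_wpM2l.
have [B B0 hB] := rat_height_orbit XS fX.
have tb : 1 < theta ^+ 4 by rewrite exprn_egt1.
(* With d = 6 * 4^i and tau = theta^(4 * 4^i), the condition B^(6 d) <= tau^(4^b0) is the 4^i-th
   power of B^36 <= theta^(4 * 4^b0). Thus b0, and with it s, is fixed before i. *)
have [b0 hb0] := exp_exp4_unbounded (B%:R ^+ 36) tb.
have hb := hb0 b0 (leqnn _).
pose s := (4 ^ b0).-1.
have [i0 hi0] := exp_exp4_unbounded (B%:R ^+ (2 * s)) tb.
pose i := maxn i0 b0.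
have hi := hi0 i (leq_maxl _ _).
have [gm sg] := monic_order4_iter E i.
pose M' := (12 ^ i.+1 * M)%N.
have [CD CD0 hCD] := eval_int_bounded (double_iter E i.+1).2 (ler0n _ M').
have [CA CA0 hCA] := eval_int_bounded (double_iter E 1).1 (ler0n _ M).
apply: (@thue_siegel_sequence (order4_iter E i) (6 * 4 ^ i) b0 M' B
  (theta ^+ (4 * 4 ^ i)) (CD ^+ 3 * CA) X) => //.
- exact: separable_order4_iter.
- rewrite prednK ?expn_gt0 //; apply: (@leq_trans (4 ^ i)).
    by rewrite leq_pexp2l // leq_maxr.
  by rewrite leq_pmull.
- by rewrite muln_gt0 expn_gt0 M0.
- by rewrite exprn_egt1 // muln_eq0 expn_eq0.
- have -> : (6 * (6 * 4 ^ i) = 36 * 4 ^ i)%N by rewrite mulnA.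
  have -> : theta ^+ (4 * 4 ^ i) ^+ (4 ^ b0) = ((theta ^+ 4) ^+ (4 ^ b0)) ^+ (4 ^ i).
    by rewrite -!exprM; congr (_ ^+ _); ring.
  by rewrite exprM lerXn2r ?nnegrE ?exprn_ge0 // ltW.
- by rewrite (exprM theta).
- move=> n; apply: (@le_trans _ _ (rat_height (X n))%:R).
    rewrite /rat_height -[leLHS]ger0_norm ?ler0z ?(ltW (denq_gt0 _)) //.
    by rewrite -intr_norm -abszE ler_nat leq_maxr.
  by rewrite -natrX ler_nat.
move=> K; have [l hl [h1 h2]] := ub1 (K + i.+1)%N.
have il : (i.+1 <= l)%N by apply: leq_trans hl; rewrite leq_addl.
exists (l - i.+1)%N; first by rewrite leq_subRL // addnC.
set n := (l - i.+1)%N; have lE : l = (n + i.+1)%N by rewrite subnK.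
have gE := order4_iter_sqr XS fX n i; rewrite -lE in gE.
have [d0 _] := orbit_double_iter XS fX n i.+1.
have XM : `|X n| <= M'%:R by rewrite /M' natrM natrX back // -lE.
rewrite -[_.[_]]/(eval_int (X n) (order4_iter E i)).
set D := eval_int (X n) (double_iter E i.+1).2 in gE d0.
set fl := cubic_form _ _ _ (X l) 1 in gE.
have fl0 : fl != 0 by exact: fX.
split=> //.
  apply/eqP => h; move/eqP: gE; rewrite h expr0n /= eq_sym mulf_eq0 expf_eq0.
  by rewrite (negPf d0) (negPf fl0).
have -> : theta ^+ (4 * 4 ^ i) ^+ (4 * 4 ^ n) = theta ^+ (4 ^ l.+1).
  rewrite -exprM lE; congr (_ ^+ _); rewrite -!expnS -expnD; congr (_ ^ _)%N.
  by rewrite addnC !addSn !addnS addnC.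
have tl0 : 0 <= theta ^+ (4 ^ l.+1) by rewrite exprn_ge0 // ltW.
rewrite -normrX gE normrM normrX -mulrA ler_pM ?exprn_ge0 ?mulr_ge0 //.
  by rewrite lerXn2r ?nnegrE ?(ltW CD0) // hCD.
apply: (@le_trans _ _ (`|fl| * `|X l.+1|)); first by rewrite ler_wpM2l.
rewrite -normrM; apply: (@le_trans _ _ `|eval_int (X l) (double_iter E 1).1|); last exact: hCA.
have -> : fl * X l.+1 = eval_int (X l) (double_iter E 1).1 / 4.
  rewrite double_iterS /= rmorph_double_num /= !eval_intC rmorph1.
  have -> : eval_int (X l) 'X = X l by rewrite /eval_int map_polyX hornerX.
  rewrite XS /double_x; have -> : fl = X l ^+ 3 + (coef_a E)%:~R * X l ^+ 2
      + (coef_b E)%:~R * X l + (coef_c E)%:~R.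
    by rewrite /fl /cubic_form; ring.
  rewrite /double_num.
  have := fl0; rewrite /fl /cubic_form !expr1n !mulr1 => fl1.
  by field.
by rewrite normrM ler_piMr // normfV normr_nat invf_le1.
Qed.

(** * Limits *)

Local Open Scope classical_set_scope.
Local Open Scope ring_scope.

Lemma Posz_maxn m n : Posz (maxn m n) = Num.max (Posz m) (Posz n).
Proof. by rewrite maxEge lez_nat /maxn ltnNge; case: leq. Qed.

Lemma inv_exp4_cvg0 (R : realType) (c : R) : (fun k : nat => c / 4 ^+ k) @ \oo --> (0 : R).
Proof.
rewrite -[X in _ --> X](mulr0 c); apply: cvgM; first exact: cvg_cst.
under eq_fun do rewrite -exprVn; apply: cvg_expr.
by rewrite ger0_norm ?invr_ge0 // invf_lt1 // ltr1n.
Qed.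

(** Adding ln C / 3 absorbs the constant, as ln C + ln C / 3 = 4 (ln C / 3): the corrected quotient
    is nonincreasing and bounded below by 0. *)
Lemma quasi_quadratic_cvg (R : realType) (H : nat -> R) (C : R) : 1 <= C ->
  (forall k, 1 <= H k) -> (forall k, H k.+1 <= C * H k ^+ 4) ->
  cvgn (fun k => ln (H k) / 4 ^+ k).
Proof.
move=> C1 H1 HS; pose v k := (ln (H k) + ln C / 3) / 4 ^+ k.
have C0 : 0 < C by apply: lt_le_trans C1.
have H0 k : 0 < H k by apply: lt_le_trans (H1 k).
have lnS k : ln (H k.+1) <= ln C + 4 * ln (H k).
  have -> : ln C + 4 * ln (H k) = ln (C * H k ^+ 4).
    by rewrite lnM ?posrE ?exprn_gt0 // lnXn // mulr_natl.
  by rewrite ler_ln ?posrE ?mulr_gt0 ?exprn_gt0.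
have cv : cvgn v.
  apply: nonincreasing_is_cvgn.
    apply/nonincreasing_seqP => k; rewrite /v exprS invfM mulrA ler_pM2r ?invr_gt0 ?exprn_gt0 //.
    by have := lnS k; lra.
  exists 0 => _ [k _ <-]; rewrite /v divr_ge0 ?exprn_ge0 // addr_ge0 ?ln_ge0 //.
  by rewrite divr_ge0 // ln_ge0.
have -> : (fun k => ln (H k) / 4 ^+ k) = (v \- (fun k => ln C / 3 / 4 ^+ k)).
  by apply/funext => k /=; rewrite /v mulrDl addrK.
by apply: is_cvgB => //; apply/cvg_ex; exists 0; exact: inv_exp4_cvg0.
Qed.

Lemma lowest_coords E x y : on_curve E (Affine x y) ->
  [/\ num_x (Affine x y) = numq x, den (Affine x y) ^+ 2 = denq x & 1 <= den (Affine x y)].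
Proof.
move=> /coords_ofP; rewrite /num_x /den; case: (coords_of _) => [[m n] e] /=.
move=> [[xE _] e1 cm _]; rewrite xE -rmorphXn /=.
have e0 : 0 < e by exact: lt_le_trans e1.
have c2 : coprime `|m| `|e ^+ 2| by move: (coprimezXr 2 cm).
rewrite coprimeq_num // coprimeq_den // gtr0_sg ?exprn_gt0 // mul1r.
by rewrite expf_eq0 (gt_eqF e0) /= gtr0_norm ?exprn_gt0.
Qed.

Section Limit.
Variables (R : realType) (E : cubic) (P : ec_point).
Hypotheses (ns : nonsingular E) (hP : on_curve E P) (inf : infinite_order E P).

Let p k := mul_point E (2 ^ k) P.
Let X k := x_coord (p k).
Let e k : R := (den (p k))%:~R.

Let pE k : exists y, [/\ p k = Affine (X k) y, y != 0, on_curve E (Affine (X k) y) &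
  X k.+1 = double_x E (X k)].
Proof.
have [x [y [h1 h2 h3 [y' h4]]]] := double_orbit hP inf k.
by exists y; rewrite /X /p h1 h4.
Qed.

Let XS k : X k.+1 = double_x E (X k). Proof. by have [y []] := pE k. Qed.

Let fX k : cubic_form (coef_a E)%:~R (coef_b E)%:~R (coef_c E)%:~R (X k) 1 != 0.
Proof.
have [y [_ y0 + _]] := pE k; rewrite /on_curve horner_cubic.
by rewrite /cubic_form !expr1n !mulr1 => <-; rewrite expf_neq0.
Qed.

Let heightE k : height R (p k) = ln (rat_height (X k))%:R.
Proof.
have [y [-> _ h _]] := pE k; rewrite /height.
have [-> -> _] := lowest_coords h; congr ln; rewrite /rat_height -[RHS]/((Posz _)%:~R).
by rewrite Posz_maxn !abszE (gtr0_norm (denq_gt0 _)).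
Qed.

Let e_ge1 k : 1 <= e k.
Proof.
by rewrite /e; have [y [-> _ h _]] := pE k; have [_ _] := lowest_coords h; rewrite ler1z.
Qed.

Let e_gt0 k : 0 < e k. Proof. exact: lt_le_trans (e_ge1 k). Qed.

Let rat_heightE k :
  (rat_height (X k))%:R = e k ^+ 2 * Num.max 1 `|ratr (X k)| :> R.
Proof.
have e2 : e k ^+ 2 = (denq (X k))%:~R.
  have [y [pk _ h _]] := pE k; have [_ h2 _] := lowest_coords h.
  by rewrite /e pk -rmorphXn /= h2.
have d0 : 0 < (denq (X k))%:~R :> R by rewrite ltr0z.
rewrite e2 maxr_pMr ?(ltW d0) // mulr1 /ratr normrM normfV (gtr0_norm d0).
rewrite mulrCA divff ?gt_eqF // mulr1 maxC -intr_norm.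
rewrite /rat_height -[LHS]/((Posz _)%:~R) Posz_maxn !abszE (gtr0_norm (denq_gt0 _)).
by rewrite !maxEle ler_int (fun_if (fun z : int => z%:~R : R)).
Qed.

Let log_excess_cvg0 : (fun k => ln (Num.max 1 `|ratr (X k) : R|) / 4 ^+ k) @ \oo --> (0 : R).
Proof.
apply/cvgrPdist_le => eps eps0.
have : 1 < expR eps by rewrite -expR0 ltr_expR.
(* [orbit_lt_exp] takes a rational base, hence a rational [t] between 1 and exp(eps). *)
move=> /rat_in_itvoo [t]; rewrite in_itv /= => /andP[t1 te].
have t1' : 1 < t by rewrite -(ltr_rat R) rmorph1.
have [K hK] := orbit_lt_exp ns XS fX t1'.
near=> k.
have Kk : (K <= k)%N by near: k; exact: nbhs_infty_ge.
have t0 : 0 < ratr t :> R by apply: lt_trans t1.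
have hm : Num.max 1 `|ratr (X k) : R| <= ratr t ^+ (4 ^ k).
  rewrite ge_max exprn_ege1 ?(ltW t1) //=.
  by rewrite -ratr_norm -rmorphXn /= ler_rat ltW // hK.
have m1 : 1 <= Num.max 1 `|ratr (X k) : R| by rewrite le_max lexx.
have m0 : 0 < Num.max 1 `|ratr (X k) : R| by apply: lt_le_trans m1.
rewrite sub0r normrN ger0_norm ?divr_ge0 ?ln_ge0 // ler_pdivrMr ?exprn_gt0 //.
have : ln (Num.max 1 `|ratr (X k) : R|) <= ln (ratr t ^+ (4 ^ k)).
  by rewrite ler_ln ?posrE ?exprn_gt0.
move/le_trans; apply; rewrite lnXn // -[leLHS]mulr_natr natrX ler_pM2r ?exprn_gt0 //.
by rewrite ltW // -ltr_expR lnK.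
Unshelve. all: by end_near. Qed.

Let height_cvg : (fun k => ln (rat_height (X k))%:R / 4 ^+ k) @ \oo -->
  (canonical_height R E P : R).
Proof.
have [C C0 hC] := rat_height_double E.
have -> : canonical_height R E P = limn (fun k => ln (rat_height (X k))%:R / 4 ^+ k : R).
  by rewrite /canonical_height; congr (limn _); apply/funext => k; rewrite -heightE.
apply: (@quasi_quadratic_cvg R (fun k => (rat_height (X k))%:R) C%:R).
- by rewrite ler1n.
- by move=> k; rewrite ler1n /rat_height leq_max !absz_gt0 denq_neq0 orbT.
by move=> k; rewrite -natrX -natrM ler_nat XS hC.
Qed.

Let den_cvg : (fun k => 2 * ln (e k) / 4 ^+ k) @ \oo --> (canonical_height R E P : R).
Proof.
rewrite -[X in _ --> X]subr0.
have -> : (fun k => 2 * ln (e k) / 4 ^+ k) = (fun k => ln (rat_height (X k))%:R / 4 ^+ k)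
    \- (fun k => ln (Num.max 1 `|ratr (X k) : R|) / 4 ^+ k).
  apply/funext => k /=; have m0 : 0 < Num.max 1 `|ratr (X k) : R| by rewrite lt_max ltr01.
  rewrite rat_heightE lnM ?posrE ?exprn_gt0 //.
  by rewrite lnXn // [in RHS]mulrDl addrK mulr_natl.
exact: cvgB height_cvg log_excess_cvg0.
Qed.

(** Since log e_k / 4^k tends to half the canonical height, the quotient e_(k+1) / e_k contributes
    1/2 - 1/8 = 3/8 after division by 4^(k+1). The shift by one discards the exceptional value of
    [F] at 0. *)
Lemma log_F_cvg : (fun k : nat => ln (ratr (F E P k) : R) / 4 ^+ k) @ \oo
    --> (3 / 8 * canonical_height R E P : R).
Proof.
rewrite -cvg_shiftS.
have -> : [sequence ln (ratr (F E P k.+1) : R) / 4 ^+ k.+1]_k =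
    (fun k => 2^-1 * (2 * ln (e k.+1) / 4 ^+ k.+1)) \-
    (fun k => 8^-1 * (2 * ln (e k) / 4 ^+ k)).
  apply/funext => k /=; rewrite fmorph_div /= !ratr_int -/(e k) -/(e k.+1).
  rewrite ln_div ?posrE // exprS; field.
  by rewrite expf_neq0.
have -> : 3 / 8 * canonical_height R E P =
    2^-1 * canonical_height R E P - 8^-1 * canonical_height R E P by field.
apply: cvgB; apply: cvgM; try exact: cvg_cst; last exact: den_cvg.
by have := den_cvg; rewrite -cvg_shiftS.
Qed.
End Limit.

Theorem theorem1p10 (R : realType) (E : cubic) (P : ec_point)
  (E_nonsingular : nonsingular E) (P_on_E : on_curve E P)
  (P_infinite_order : infinite_order E P) :
  (fun k : nat => ln (ratr (F E P k) : R) / 4 ^+ k) @ \oo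
    --> (3 / 8 * canonical_height R E P : R).
Proof. exact: log_F_cvg. Qed.
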